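(* Let $a,b\in\mathbb{R}$ with $b>1$. Then $$\pi=\frac{\sqrt{b^4-1}\,\sqrt{1-2b^2\cos2a+b^4}}{b^2\,F_D^{(3)}\!\left(\tfrac12;\tfrac12,\tfrac12,\tfrac12;1\,\Big|\,\dfrac1{1-b^4},\dfrac1{1-b^2e^{-2ia}},\dfrac1{1-b^2e^{2ia}}\right)}\left(\frac{K\!\left(\dfrac{2b\sin a}{\sqrt{1-2b^2\cos2a+b^4}}\right)}{\sqrt{1-2b^2\cos2a+b^4}}+\frac{K\!\left(\dfrac{2b\cos a}{1+b^2}\right)}{1+b^2}\right).$$
   Context: $K(k)=\int_0^1\frac{dx}{\sqrt{(1-x^2)(1-k^2x^2)}}$ is the complete elliptic integral of the first kind, as a function of the modulus $k$. The Lauricella function of $n$ variables is $F_D^{(n)}(\alpha;\beta_1,\dots,\beta_n;\gamma\,|\,x_1,\dots,x_n)=\sum_{m_1,\dots,m_n\ge0}\frac{(\alpha)_{m_1+\cdots+m_n}(\beta_1)_{m_1}\cdots(\beta_n)_{m_n}}{(\gamma)_{m_1+\cdots+m_n}\,m_1!\cdots m_n!}x_1^{m_1}\cdots x_n^{m_n}$ for $|x_j|<1$, with $(x)_k$ the Pochhammer symbol. For $\operatorname{Re}\gamma>\operatorname{Re}\alpha>0$ it equals, and outside the region of convergence is defined by analytic continuation through, $\frac{\Gamma(\gamma)}{\Gamma(\alpha)\Gamma(\gamma-\alpha)}\int_0^1\frac{u^{\alpha-1}(1-u)^{\gamma-\alpha-1}}{(1-x_1u)^{\beta_1}\cdots(1-x_nu)^{\beta_n}}\,du$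 (principal branches, $x_j\notin[1,\infty)$). Here $i$ is the imaginary unit. *)

(* Defs.v *)
From HB Require Import structures.
From mathcomp Require Export all_boot all_order all_algebra.
From mathcomp.real_closed Require Export complex.
From mathcomp Require Export all_classical all_reals all_analysis.

Set Implicit Arguments.
Unset Strict Implicit.
Unset Printing Implicit Defensive.

Import Order.TTheory GRing.Theory Num.Theory.
Import numFieldNormedType.Exports.

Local Open Scope classical_set_scope.
Local Open Scope ring_scope.
Local Open Scope complex_scope.

Section ComplexFunctions.
Context {R : realType}.
Implicit Types (z s : R[i]).

Definition cexp z : R[i] :=
  (expR (complex.Re z))%:C * (cos (complex.Im z) +i* sin (complex.Im z)).

(* The principal argument, with values in ]-pi, pi]; meaningless at 0. *)
Definition carg z : R :=
  if 0 <= complex.Im z then acos (complex.Re z / Normc.normc z)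
  else - acos (complex.Re z / Normc.normc z).

Definition clog z : R[i] := ln (Normc.normc z) +i* carg z.

(* The principal branch of z ^ s; only used for z != 0. *)
Definition cpow z s : R[i] := cexp (s * clog z).

Definition cintegral (D : set R) (f : R -> R[i]) : R[i] :=
  (\int[lebesgue_measure]_(x in D) complex.Re (f x))
    +i* (\int[lebesgue_measure]_(x in D) complex.Im (f x)).

Definition climn (u : nat -> R[i]) : R[i] :=
  limn (fun N => complex.Re (u N)) +i* limn (fun N => complex.Im (u N)).

(* Euler's integral, which represents Gamma on the half-plane Re s > 0. *)
Definition cGamma s : R[i] :=
  cintegral `]0, +oo[ (fun t => cpow t%:C (s - 1) * (expR (- t))%:C).

Definition pochhammer z (k : nat) : R[i] := \prod_(j < k) (z + j%:R).

End ComplexFunctions.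

Definition ellipticK {R : realType} (k : R) : R :=
  \int[lebesgue_measure]_(x in `]0, 1[)
    (Num.sqrt ((1 - x ^+ 2) * (1 - k ^+ 2 * x ^+ 2)))^-1.

Section Lauricella.
Context {R : realType} {n : nat}.
Variables (alpha : R[i]) (beta : n.-tuple R[i]) (gamma : R[i]).
Variable x : n.-tuple R[i].

Definition lauricellaD_term (m : 'I_n -> nat) : R[i] :=
  pochhammer alpha (\sum_j m j)
    * (\prod_j pochhammer (tnth beta j) (m j))
    / (pochhammer gamma (\sum_j m j) * \prod_j ((m j)`!)%:R)
    * \prod_j tnth x j ^+ m j.

(* The n-fold series converges absolutely in the open unit polydisc, so its
   sum is the limit of the partial sums over the cubes m_1, ..., m_n < N. *)
Definition lauricellaD_series : R[i] :=
  climn (fun N => \sum_(m : {ffun 'I_n -> 'I_N})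
                    lauricellaD_term (fun j => m j : nat)).

Definition lauricellaD_integral : R[i] :=
  cGamma gamma / (cGamma alpha * cGamma (gamma - alpha))
    * cintegral `]0, 1[ (fun u =>
        cpow u%:C (alpha - 1) * cpow (1 - u)%:C (gamma - alpha - 1)
          / \prod_j cpow (1 - tnth x j * u%:C) (tnth beta j)).

(* F_D^(n)(alpha; beta_1, ..., beta_n; gamma | x_1, ..., x_n).  Outside the
   unit polydisc the value is the one given by the analytic continuation,
   under the conditions Re gamma > Re alpha > 0 and x_j \notin [1, +oo[. *)
Definition lauricellaD : R[i] :=
  if [forall j, `|tnth x j| < 1] then lauricellaD_series
  else lauricellaD_integral.

End Lauricella.

(* Main.v *)
Require Import Defs.
From mathcomp Require Import measurable_realfun ring lra.
Import Order.TTheory GRing.Theory Num.Theory.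
Import numFieldNormedType.Exports.

(** Write B = b^2, c = cos 2a, q_e(v) = v^2 - e B v + B^2 and
    omega(u) = 1 / sqrt (u (1 - u)).

    The Euler integral of this Lauricella function is
    (1/pi) int_0^1 omega(u) / sqrt ((1 - x1 u) (1 - x2 u) (1 - x3 u)) du,
    where Gamma(1/2)^2 = pi gives the factor ([cGamma_half]).  The variables
    x2 and x3 are conjugate, so the two principal square roots multiply to the
    modulus of 1 - x2 u ([cpow_half_mul_conj]).  With v = 1 - u, the integral
    is a constant times the hyperelliptic integral of
    dv / sqrt (v (1 - v) (B^2 - v) q_2c(v)).

    The branch points 0, oo, 1, B^2, B e^(2ia), B e^(-2ia) of this curve of
    genus 2 are exchanged in pairs by v |-> B^2 / v, and a genus 2 curve with
    such an extra involution covers two elliptic curves.  Concretely, the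
    substitution 1 - y^2 = q_e(1) v / q_e(v) in K(k) yields the integrand
    (B^2 - v^2) / (2 sqrt (v (1 - v) (B^2 - v) q_e(v) q_e'(v))), up to the
    factor sqrt (q_e'(1)), as soon as k^2 q_e'(1) = B (e - e')
    ([ellipticK_kernel]).  Since q_2 = (B - v)^2 and q_(-2) = (B + v)^2, the
    choices (e, e') = (2, 2c) and (2c, -2) give the hyperelliptic integrand
    multiplied by (B + v) / 2 and by (B - v) / 2; these add up to B times the
    hyperelliptic integrand ([elliptic_kernelD], [ellipticK_sum]), and the two
    moduli are those of the identity.

    When all three variables lie in the unit disc, F_D is the sum of its power
    series, which has to be identified with the Euler integral
    ([lauricellaD_seriesE]).  With c_M = (1/2)_M / M!, Wallis's formula reads
    int_0^1 omega(u) u^M du = pi c_M, hence a partial sum over a cube is the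
    integral of omega(u) times the product of the truncations P_N(x_j u) of the
    series of (1 - w)^(-1/2), and dominated convergence applies.  No branch of
    the square root enters the limit: as the self-convolution of c is
    constantly 1, the square of P_N starts with 1 + w + ... + w^(N-1), so
    P_N(w)^2 (1 - w) tends to 1 for |w| < 1 ([sqr_inv_sqrt_poly_bound]).  This
    determines the limit of |P_N(x2 u)|^2, the product of the two conjugate
    factors, and that of P_N(x1 u), which is nonnegative. *)

Local Open Scope classical_set_scope.
Local Open Scope ring_scope.
Local Open Scope complex_scope.

(** * Change of variables on an open interval *)

Section Substitution.
Local Open Scope classical_set_scope.
Context {R : realType}.
Notation mu := (@lebesgue_measure R).

Lemma is_derive1_continuous (f : R -> R) (x df : R) :
  is_derive x 1 f df -> {for x, continuous f}.
Proof. by case=> dfx _; exact/differentiable_continuous/derivable1_diffP. Qed.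

(** Monotone convergence over two exhaustions: it carries a change of
    variables from segments, where it is classical, to sets on which the
    integrand may blow up at the ends. *)
Lemma ge0_integral_exhaustion (A B : (set R)^nat)
    (f g : measurableTypeR R -> \bar R) :
  (forall n, measurable (A n)) -> (forall n, measurable (B n)) ->
  nondecreasing_seq A -> nondecreasing_seq B ->
  (forall n, measurable_fun (A n) f) -> (forall n, measurable_fun (B n) g) ->
  (forall n x, A n x -> 0 <= f x)%E -> (forall n x, B n x -> 0 <= g x)%E ->
  (forall n, \int[mu]_(x in A n) f x = \int[mu]_(x in B n) g x)%E ->
  (\int[mu]_(x in \bigcup_n A n) f x = \int[mu]_(x in \bigcup_n B n) g x)%E.
Proof.
move=> mA mB ndA ndB mf mg f0 g0 fg.
have cf := ge0_nondecreasing_set_cvg_integral (mu := mu) ndA mA mf f0.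
have := ge0_nondecreasing_set_cvg_integral (mu := mu) ndB mB mg g0.
under eq_fun do rewrite -fg.
by move/(cvg_unique (@ereal_hausdorff R) cf).
Qed.

Lemma itvoo_bigcup_itvcc (a b : R) : a < b ->
  `]a, b[%classic = \bigcup_n `[a + (b - a) / n.+2%:R, b - (b - a) / n.+2%:R]%classic.
Proof.
move=> ab; have ba0 : 0 < b - a by rewrite subr_gt0.
apply/seteqP; split=> [x /=|x [n _ /=]]; rewrite !in_itv/=; last first.
  have : 0 < (b - a) / n.+2%:R by rewrite divr_gt0.
  by set e := (_ / _) => e0 /andP[ax xb]; apply/andP; split; lra.
move=> /andP[ax xb].
pose m := Num.min (x - a) (b - x).
have m0 : 0 < m by rewrite lt_min !subr_gt0 ax.
(* x is at distance at least m from both ends, so any n > (b - a) / m will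
   do. *)
exists (Num.bound ((b - a) / m)) => //=; rewrite in_itv/=.
have : (b - a) / m < (Num.bound ((b - a) / m)).+2%:R.
  apply: (lt_trans (archi_boundP _)); first by rewrite divr_ge0// ltW.
  by rewrite ltr_nat.
rewrite ltr_pdivrMr// mulrC -ltr_pdivrMr// lt_min.
by set e := (_ / _) => /andP[h1 h2]; apply/andP; split; lra.
Qed.

(** Unlike for a change of variables on a closed segment, [G] and [F'] may
    blow up at the end points, as the integrands of [ellipticK] and of the
    Euler integral do. *)
Lemma ge0_integration_by_substitution_oo (F F' G : R -> R) (a b : R) : a < b ->
  {within `[a, b], continuous F} ->
  (forall x, a < x < b -> is_derive x 1 F (F' x)) ->
  (forall x, a < x < b -> {for x, continuous F'}) ->
  (forall x, a < x < b -> 0 < F' x) ->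
  (forall x, F a < x < F b -> {for x, continuous G}) ->
  (forall x, F a < x < F b -> 0 <= G x) ->
  (\int[mu]_(x in `]F a, F b[) (G x)%:E =
   \int[mu]_(x in `]a, b[) (G (F x) * F' x)%:E)%E.
Proof.
move=> ab cF dF cF' F'0 cG G0.
have derF x : x \in `]a, b[%R -> F^`() x = F' x.
  by rewrite in_itv/= => /dF [_]; rewrite derive1E.
have incrF x y : a <= x -> x < y -> y <= b -> F x < F y.
  apply: gtr0_derive1_incr => //.
    by move=> z; rewrite in_itv/= => /dF [].
  by move=> z zab; rewrite derF//; apply: F'0; move: zab; rewrite in_itv.
have ba0 : 0 < b - a by rewrite subr_gt0.
pose a_ n : R := a + (b - a) / n.+2%:R.
pose b_ n : R := b - (b - a) / n.+2%:R.
have e0 n : 0 < (b - a) / n.+2%:R by rewrite divr_gt0.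
have a_gt n : a < a_ n by rewrite /a_ ltrDl.
have b_lt n : b_ n < b by rewrite /b_ gtrDl oppr_lt0.
have a_b n : a_ n <= b_ n.
  have : (b - a) / n.+2%:R <= (b - a) / 2.
    by rewrite ler_pM2l// lef_pV2 ?posrE// ler_nat.
  by rewrite /a_ /b_; set e := (_ / _.+2%:R); lra.
have eS n m : (n <= m)%N -> (b - a) / m.+2%:R <= (b - a) / n.+2%:R.
  by move=> nm; rewrite ler_pM2l// lef_pV2 ?posrE// ler_nat !ltnS.
have a_S n m : (n <= m)%N -> a_ m <= a_ n by move=> /eS; rewrite /a_ lerD2l.
have b_S n m : (n <= m)%N -> b_ n <= b_ m by move=> /eS; rewrite /b_ lerD2l lerN2.
have leF x y : a <= x -> x <= y -> y <= b -> F x <= F y.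
  by move=> ax; rewrite le_eqVlt => /predU1P[->//|xy yb]; exact/ltW/incrF.
have inab n x : a_ n <= x <= b_ n -> a < x < b.
  move=> /andP[ax xb]; rewrite (lt_le_trans (a_gt n) ax)/=.
  exact: le_lt_trans xb (b_lt n).
have inFab n x : F (a_ n) <= x <= F (b_ n) -> F a < x < F b.
  move=> /andP[ax xb].
  rewrite (lt_le_trans _ ax) ?incrF//=.
  - by apply: (le_lt_trans xb); rewrite incrF// ltW// (lt_le_trans (a_gt n)).
  - exact: le_trans (a_b n) (ltW (b_lt n)).
have -> : `]F a, F b[%classic = \bigcup_n `[F (a_ n), F (b_ n)]%classic.
  apply/seteqP; split=> [y /=|y [n _ /=]]; rewrite !in_itv/=; last exact: inFab.
  move=> /andP[ay yb].
  (* every value strictly between F a and F b is taken inside ]a, b[, hence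
     inside one of the segments *)
  have [|x] := @IVT R F a b y (ltW ab) cF.
    by rewrite ge_min le_max (ltW ay) (ltW yb) orbT.
  rewrite in_itv/= => /andP[ax xb] Fxy.
  have : `]a, b[%classic x.
    rewrite /= in_itv/= !lt_neqAle ax xb !andbT; apply/andP; split; apply/eqP.
      by move=> axe; move: ay; rewrite axe Fxy ltxx.
    by move=> axe; move: yb; rewrite -axe Fxy ltxx.
  rewrite itvoo_bigcup_itvcc// => -[n _ /=]; rewrite in_itv/= => /andP[h1 h2].
  exists n => //=; rewrite in_itv/= -Fxy; apply/andP; split; apply: leF => //.
    exact/ltW/a_gt.
  exact/ltW/b_lt.
rewrite itvoo_bigcup_itvcc//.
apply: ge0_integral_exhaustion => //.
- by move=> n m nm; apply/subsetPset => x /=; rewrite !in_itv/= => /andP[h1 h2];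
    rewrite (le_trans _ h1) ?(le_trans h2)//; apply: leF => //; 
    rewrite ?a_S ?b_S ?(ltW (a_gt _)) ?(ltW (b_lt _))//;
    [exact: le_trans (ltW (a_gt _)) (a_b _)|exact: le_trans (a_b _) (ltW (b_lt _))].
- by move=> n m nm; apply/subsetPset => x /=; rewrite !in_itv/= => /andP[h1 h2];
    rewrite (le_trans _ h1) ?(le_trans h2)//; [exact: b_S|exact: a_S].
- move=> n; apply/measurable_EFinP; apply: subspace_continuous_measurable_fun => //.
  apply: continuous_in_subspaceT => x; rewrite inE/= in_itv/= => /inFab.
  exact: cG.
- move=> n; apply/measurable_EFinP; apply: subspace_continuous_measurable_fun => //.
  apply: continuous_in_subspaceT => x; rewrite inE/= in_itv/= => /inab xab.
  apply: continuousM; last exact: cF'.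
  apply: continuous_comp.
    exact: is_derive1_continuous (dF _ xab).
  by apply: cG; case/andP: xab => ax xb; rewrite !incrF// ltW.
- by move=> n x /=; rewrite in_itv/= => /inFab xab; rewrite lee_fin G0.
- move=> n x /=; rewrite in_itv/= => /inab xab; rewrite lee_fin mulr_ge0//.
    by apply: G0; case/andP: xab => ax xb; rewrite !incrF// ltW.
  exact/ltW/F'0.
move=> n.
have cFx x : a < x < b -> {for x, continuous F}.
  by move=> /dF; exact: is_derive1_continuous.
have ina x : a_ n <= x <= b_ n -> {for x, continuous F^`()}.
  move=> /inab xab; have : F' z @[z --> x] --> F' x := cF' _ xab.
  rewrite /prop_for /continuous_at derF ?in_itv//=; apply: cvg_trans.
  apply: near_eq_cvg; near=> z; rewrite derF//.
  by near: z; exact: near_in_itvoo.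
rewrite integration_by_substitution_increasing//.
- apply: eq_integral => x; rewrite inE/= in_itv/= => /inab xab.
  by congr (EFin _); rewrite /= !fctE/= derF.
- move=> x y; rewrite !in_itv/= => /inab/andP[ax _] /inab/andP[_ yb] xy.
  by apply: incrF => //; exact: ltW.
- move=> x; rewrite in_itv/= => /andP[/ltW h1 /ltW h2]; apply: ina.
  by rewrite h1.
- by apply: (cvgP (F^`() (a_ n))); apply/cvg_at_right_filter/ina; rewrite lexx a_b.
- by apply: (cvgP (F^`() (b_ n))); apply/cvg_at_left_filter/ina; rewrite lexx a_b.
- split.
  + by move=> x; rewrite in_itv/= => /andP[/ltW h1 /ltW h2];
      have /dF[] := inab n x (introT andP (conj h1 h2)).
  + by apply/cvg_at_right_filter/cFx/(inab n); rewrite lexx a_b.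
  + by apply/cvg_at_left_filter/cFx/(inab n); rewrite lexx a_b.
- apply: continuous_in_subspaceT => x; rewrite inE/= in_itv/= => /inFab.
  exact: cG.
Unshelve. all: by end_near. Qed.

End Substitution.

(** * The arcsine weight and its moments *)

(** (1/2)_M / M!, that is, binomial(2M, M) / 4^M. *)
Definition central_coef {F : fieldType} (M : nat) : F :=
  \prod_(j < M) ((2^-1 + j%:R) / j.+1%:R).

Lemma central_coefS (F : fieldType) M :
  central_coef M.+1 = central_coef M * ((2^-1 + M%:R) / M.+1%:R) :> F.
Proof. by rewrite /central_coef big_ord_recr. Qed.

Section Arcsine.
Local Open Scope classical_set_scope.
Context {R : realType}.
Notation mu := (@lebesgue_measure R).

(** The density of the arcsine law, without the normalisation 1 / pi. *)
Definition arcsine_weight (u : R) : R := (Num.sqrt (u * (1 - u)))^-1.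

Lemma arcsine_weight_ge0 u : 0 <= arcsine_weight u.
Proof. by rewrite invr_ge0 sqrtr_ge0. Qed.

Lemma arcsine_weight_continuous u : 0 < u < 1 ->
  {for u, continuous arcsine_weight}.
Proof.
move=> /andP[u0 u1]; apply: continuousV.
  by rewrite gt_eqF// sqrtr_gt0 mulr_gt0// subr_gt0.
apply: continuous_comp; last exact: sqrt_continuous.
by apply: continuousM => //; apply: continuousB => //; exact: cvg_cst.
Qed.

(** The substitution u = sin^2 t removes both singularities of the weight. *)
Lemma ge0_integral_arcsine (h : R -> R) :
  (forall u, 0 < u < 1 -> {for u, continuous h}) ->
  (forall u, 0 < u < 1 -> 0 <= h u) ->
  (\int[mu]_(u in `]0%R, 1%R[) (arcsine_weight u * h u)%:E =
   \int[mu]_(t in `]0%R, (pi / 2)%R[) (2 * h (sin t ^+ 2))%:E)%E.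
Proof.
move=> ch h0.
have pih : 0 < (pi : R) / 2 by rewrite divr_gt0// pi_gt0.
have sc (t : R) : 0 < t < pi / 2 -> 0 < sin t /\ 0 < cos t.
  move=> tpi; split; first exact: sin_gt0_pihalf.
  apply: cos_gt0_pihalf; case/andP: tpi => t0 ->.
  by rewrite (lt_trans _ t0)// oppr_lt0.
have -> : `]0%R, 1%R[ = `](sin 0 ^+ 2 : R)%R, (sin (pi / 2) ^+ 2)%R[ :> set R.
  by rewrite sin0 sin_pihalf expr0n expr1n.
have dsin2 (t : R) : 0 < t < pi / 2 ->
    is_derive t 1 (fun t => sin t ^+ 2) (2 * sin t * cos t).
  by move=> _; apply: trigger_derive; rewrite /GRing.scale/=; ring.
rewrite (ge0_integration_by_substitution_oo (fun t => sin t ^+ 2) _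
   (fun u => arcsine_weight u * h u) 0 (pi / 2) pih _ dsin2)//.
- apply: eq_integral => t; rewrite inE/= in_itv/= => /sc[s0 c0].
  congr (EFin _); rewrite /arcsine_weight -cos2sin2 -exprMn sqrtr_sqr.
  rewrite gtr0_norm ?mulr_gt0//; field.
  by rewrite !gt_eqF.
- apply: continuous_subspaceT => t.
  apply: (@continuous_comp _ _ _ sin (fun x => x ^+ 2)).
    exact: continuous_sin.
  exact: exprn_continuous.
- move=> t _; apply: continuousM; last exact: continuous_cos.
  by apply: continuousM; [exact: cvg_cst|exact: continuous_sin].
- by move=> t /sc[s0 c0]; rewrite !mulr_gt0.
- move=> u; rewrite sin0 sin_pihalf expr0n expr1n/= => u01.
  by apply: continuousM; [exact: arcsine_weight_continuous|exact: ch].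
- move=> u; rewrite sin0 sin_pihalf expr0n expr1n/= => u01.
  by rewrite mulr_ge0 ?arcsine_weight_ge0 ?h0.
Qed.

Lemma integrable_sin_even M :
  mu.-integrable `[0, (pi / 2)] (EFin \o (fun t : R => sin t ^+ (2 * M))).
Proof.
apply: continuous_compact_integrable; first exact: segment_compact.
apply: continuous_subspaceT => t.
apply: (@continuous_comp _ _ _ sin (fun x => x ^+ (2 * M))).
  exact: continuous_sin.
exact: exprn_continuous.
Qed.

Lemma integrable_scaled_sin_even (r : R) M :
  mu.-integrable `[0, (pi / 2)] (EFin \o (fun t : R => r * sin t ^+ (2 * M))).
Proof.
apply: (@eq_integrable _ (measurableTypeR R) _ _ _ _
  (fun t => r%:E * (sin t ^+ (2 * M))%:E)%E) => //.
by apply: integrableZl => //; exact: integrable_sin_even.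
Qed.

(** Wallis's recurrence: sin^(2M+1) cos vanishes at both ends of the
    interval, so its derivative has integral zero. *)
Lemma Rintegral_sin_even M :
  \int[mu]_(t in `[0, (pi / 2)]) (sin t ^+ (2 * M)) = pi / 2 * central_coef M.
Proof.
have pih : 0 < (pi : R) / 2 by rewrite divr_gt0// pi_gt0.
elim: M => [|M IH].
  rewrite muln0; under eq_Rintegral do rewrite expr0.
  rewrite Rintegral_cst// mul1r /central_coef big_ord0 mulr1.
  have mu_pih : mu `[0, (pi / 2)] = (pi / 2)%:E.
    have := lebesgue_measure_itv `[0, (pi / 2 : R)]%R.
    by rewrite /= lte_fin pih -EFinD subr0.
  exact: (congr1 fine mu_pih).
pose r : R := (2 * M + 1)%:R / (2 * M + 2)%:R.
pose f (t : R) := sin t ^+ (2 * M.+1) - r * sin t ^+ (2 * M).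
have irM := integrable_scaled_sin_even r M.
have dF (x : R) : is_derive x 1
    (fun t => - (2 * M + 2)%:R^-1 * (sin t ^+ (2 * M).+1 * cos t)) (f x).
  have d1 := is_deriveX (2 * M).+1 (is_derive_sin x).
  have d2 := is_deriveZ (- (2 * M + 2)%:R^-1) (is_deriveM d1 (is_derive_cos x)).
  rewrite (_ : (fun t => _) =
    - (2 * M + 2)%:R^-1 \*: (sin ^+ (2 * M).+1 * cos)); last first.
    by apply/funext => t; rewrite /= !fctE.
  apply: (is_derive_eq d2); rewrite !fctE /GRing.scale/= /f /r.
  have -> : (2 * M.+1 = (2 * M).+2)%N by rewrite mulnS.
  rewrite !exprS; set S := sin x ^+ _.
  transitivity (- (2 * M + 2)%:R^-1 * S * ((2 * M).+1%:R * cos x ^+ 2 - sin x ^+ 2)).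
    by ring.
  rewrite cos2sin2 -[(2 * M).+1]addn1 !(natrD _ (2 * M)) (natrM _ 2).
  field.
  by rewrite -natrM -natrD pnatr_eq0 addn2.
have : \int[mu]_(t in `[0, (pi / 2)]) f t = 0.
  rewrite /Rintegral (@continuous_FTC2 _ f
    (fun t => - (2 * M + 2)%:R^-1 * (sin t ^+ (2 * M).+1 * cos t)))//.
  - by rewrite cos_pihalf sin0 expr0n/= mul0r !mulr0 subrr.
  - rewrite /f; apply: continuous_subspaceT => t; apply: cvgB.
      apply: (@continuous_comp _ _ _ sin (fun x => x ^+ (2 * M.+1))).
        exact: continuous_sin.
      exact: exprn_continuous.
    apply: cvgM; first exact: cvg_cst.
    apply: (@continuous_comp _ _ _ sin (fun x => x ^+ (2 * M))).
      exact: continuous_sin.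
    exact: exprn_continuous.
  - have cF x := is_derive1_continuous _ _ _ (dF x).
    split; first by move=> x _; case: (dF x).
      exact/cvg_at_right_filter/cF.
    exact/cvg_at_left_filter/cF.
  - by move=> x _; rewrite derive1E; case: (dF x).
rewrite RintegralB//; last exact: integrable_sin_even.
rewrite RintegralZl//; last exact: integrable_sin_even.
move/eqP; rewrite subr_eq0 => /eqP ->; rewrite IH central_coefS /r.
rewrite -[M.+1]addn1 !(natrD _ (2 * M)) (natrD _ M) (natrM _ 2); field.
rewrite natr1 pnatr_eq0 /=.
by rewrite -natrM -natrD pnatr_eq0 addn2.
Qed.

Lemma integral_arcsine_moment M :
  (\int[mu]_(u in `]0%R, 1%R[) (arcsine_weight u * u ^+ M)%:E =
   (pi * central_coef M)%:E)%E.
Proof.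
rewrite (@ge0_integral_arcsine (fun u => u ^+ M)); last 2 first.
  by move=> u _; exact: exprn_continuous.
  by move=> u /andP[/ltW u0 _]; exact: exprn_ge0.
under eq_integral do rewrite -exprM.
have iM := integrable_sin_even M.
rewrite integral_itv_obnd_cbnd; last first.
  apply: (@measurable_funS _ _ _ _ `[0, (pi / 2)]%classic) => //.
    exact: subset_itv_oo_cc.
  exact: (measurable_int _ (integrable_scaled_sin_even 2 M)).
rewrite integral_itv_bndo_bndc; last first.
  apply: (@measurable_funS _ _ _ _ `[0, (pi / 2)]%classic) => //.
    exact: subset_itv_co_cc.
  exact: (measurable_int _ (integrable_scaled_sin_even 2 M)).
under eq_integral do rewrite EFinM.
rewrite integralZl// -[X in (_ * X)%E]fineK; last exact: integrable_fin_num.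
by rewrite -/(Rintegral _ _ _) Rintegral_sin_even -EFinM; congr (EFin _); field.
Qed.

Lemma integrable_arcsine_weight :
  mu.-integrable `]0, 1[ (EFin \o arcsine_weight).
Proof.
apply/integrableP; split.
  apply/measurable_EFinP; apply: open_continuous_measurable_fun => //.
  by move=> u; rewrite inE/= in_itv/=; exact: arcsine_weight_continuous.
rewrite (_ : (\int[mu]_(x in _) _)%E = (pi * central_coef 0)%:E) ?ltry//.
rewrite -integral_arcsine_moment; apply: eq_integral => u _.
by rewrite /= expr0 mulr1 ger0_norm ?arcsine_weight_ge0.
Qed.

End Arcsine.

(** * The elliptic integral in the hyperelliptic variable *)

Section EllipticK.
Local Open Scope classical_set_scope.
Context {R : realType}.
Notation mu := (@lebesgue_measure R).

(** For e = 2 cos t this is |v - B e^(it)|^2. *)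
Definition quad (B e v : R) : R := v ^+ 2 - e * B * v + B ^+ 2.

(** It is (B - v)^2 + (2 - e) B v, with v < B. *)
Lemma quad_gt0 (B e v : R) : 1 < B -> e <= 2 -> 0 <= v <= 1 -> 0 < quad B e v.
Proof.
move=> B1 e2 /andP[v0 v1].
have -> : quad B e v = (B - v) ^+ 2 + (2 - e) * (B * v) by rewrite /quad; ring.
apply: ltr_wpDr; first by rewrite !mulr_ge0// ?subr_ge0// ltW// (lt_trans ltr01).
by rewrite exprn_gt0// subr_gt0 (le_lt_trans v1).
Qed.

Lemma onem_continuous : continuous (fun u : R => 1 - u).
Proof. by move=> u; apply: cvgB; [exact: cvg_cst|exact: cvg_id]. Qed.

Lemma onem_sqr_continuous : continuous (fun u : R => (1 - u) ^+ 2).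
Proof.
move=> u; apply: (@continuous_comp _ _ _ (fun u : R => 1 - u) (fun v => v ^+ 2)).
  exact: onem_continuous.
exact: exprn_continuous.
Qed.

Lemma quad_onem_continuous (B e : R) :
  continuous (fun u : R => quad B e (1 - u)).
Proof.
move=> u; apply: cvgD; last exact: cvg_cst.
apply: cvgB; first exact: onem_sqr_continuous.
by apply: cvgM; [exact: cvg_cst|exact: onem_continuous].
Qed.

(** The integrand of [ellipticK] in the variable u = 1 - v, without the
    arcsine weight and a constant; see [integral_ellipticK]. *)
Definition elliptic_kernel (B e e' u : R) : R :=
  (B ^+ 2 - (1 - u) ^+ 2) /
  (2 * Num.sqrt ((B ^+ 2 - (1 - u)) * (quad B e (1 - u) * quad B e' (1 - u)))).

(** What remains of the change of variables in [integral_ellipticK] when q, q',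
    S, S' stand for the values of q_e and q_e' at v and at 1, d for B^2 - v and
    N for B^2 - v^2. *)
Lemma elliptic_jacobian (u v d q q' S S' N : R) :
  0 < u -> 0 < v -> 0 < d -> 0 < q -> 0 < q' -> 0 < S -> 0 < S' ->
  (Num.sqrt (S * v / q * (S * q' / (S' * q))))^-1 *
    (S * N / q ^+ 2 / (2 * Num.sqrt (u * d / q))) =
  (Num.sqrt (u * v))^-1 * (Num.sqrt S' * (N / (2 * Num.sqrt (d * (q * q'))))).
Proof.
move=> u0 v0 d0 q0 q'0 S0 S'0.
have -> : S * v / q * (S * q' / (S' * q)) = (S / q) ^+ 2 * (v * q' / S').
  by field; rewrite !gt_eqF.
have q_sqrt := sqr_sqrtr (ltW q0).
rewrite [Num.sqrt ((S / q) ^+ 2 * _)]sqrtrM ?sqr_ge0//.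
rewrite sqrtr_sqr gtr0_norm ?divr_gt0//.
rewrite !(sqrtrM, sqrtrV) ?mulr_ge0 ?ltW//.
have := sqrtr_gt0 q; rewrite q0; move: q_sqrt.
move: (Num.sqrt q) => r <- r0.
by field; rewrite !lt0r_neq0 ?sqrtr_gt0.
Qed.

(** The substitution 1 - y^2 = q_e(1) v / q_e(v) with v = 1 - u. The
    condition on the modulus is what turns 1 - k^2 y^2 into a multiple of
    q_e'(v) / q_e(v). *)
Lemma integral_ellipticK (B e e' k : R) :
  1 < B -> e <= 2 -> e' <= 2 -> k ^+ 2 * quad B e' 1 = B * (e - e') ->
  (\int[mu]_(y in `]0%R, 1%R[)
     ((Num.sqrt ((1 - y ^+ 2) * (1 - k ^+ 2 * y ^+ 2)))^-1)%:E =
   \int[mu]_(u in `]0%R, 1%R[) (arcsine_weight u *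
      (Num.sqrt (quad B e' 1) * elliptic_kernel B e e' u))%:E)%E.
Proof.
move=> B1 e2 e'2 kE.
have B0 : 0 < B by exact: lt_trans ltr01 B1.
have onem01 (u : R) : 0 <= u <= 1 -> 0 <= 1 - u <= 1.
  by move=> /andP[u0 u1]; rewrite subr_ge0 u1 gerBl.
have itv01 : 0 <= (1 : R) <= 1 by rewrite ler01 lexx.
have S0 : 0 < quad B e 1 by exact: quad_gt0.
have S'0 : 0 < quad B e' 1 by exact: quad_gt0.
have qu0 (u : R) : 0 <= u <= 1 -> 0 < quad B e (1 - u).
  by move=> /onem01; exact: quad_gt0.
have q'u0 (u : R) : 0 <= u <= 1 -> 0 < quad B e' (1 - u).
  by move=> /onem01; exact: quad_gt0.
(* y2 is y^2 as a function of u; it vanishes at u = 0 only, so y is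
   differentiable inside the interval *)
pose y2 (u : R) : R := 1 - quad B e 1 * (1 - u) / quad B e (1 - u).
have y2E (u : R) : 0 <= u <= 1 ->
    y2 u = u * (B ^+ 2 - (1 - u)) / quad B e (1 - u).
  move=> /qu0/lt0r_neq0; rewrite /y2 /quad => q0.
  by field.
have BB (v : R) : v <= 1 -> 0 < B ^+ 2 - v.
  by move=> v1; rewrite subr_gt0 (le_lt_trans v1)// expr_gt1// ltW.
have y2_gt0 (u : R) : 0 < u < 1 -> 0 < y2 u.
  move=> /andP[u0 u1]; rewrite y2E ?(ltW u0) ?(ltW u1)// divr_gt0//.
    by rewrite mulr_gt0// BB// gerBl ltW.
  by rewrite qu0// (ltW u0) (ltW u1).
pose dy2 (u : R) : R :=
  quad B e 1 * (B ^+ 2 - (1 - u) ^+ 2) / quad B e (1 - u) ^+ 2.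
have y2c (u : R) : 0 <= u <= 1 -> {for u, continuous y2}.
  move=> /qu0/lt0r_neq0 q0.
  apply: cvgB; first exact: cvg_cst.
  apply: cvgM.
    by apply: cvgM; [exact: cvg_cst|exact: onem_continuous].
  by apply: cvgV => //; exact: quad_onem_continuous.
have dy2P (u : R) : 0 < u < 1 -> is_derive u 1 y2 (dy2 u).
  move=> /andP[u0 u1].
  have q0 : quad B e (1 - u) != 0 by rewrite lt0r_neq0// qu0// (ltW u0) (ltW u1).
  have dq : is_derive u 1 (fun u : R => quad B e (1 - u)) (- (2 * (1 - u)) + e * B).
    rewrite /quad; apply: trigger_derive; rewrite /GRing.scale/=.
    by ring.
  have dqV := is_deriveV (f := fun u : R => quad B e (1 - u)) q0 dq.
  rewrite /y2; apply: trigger_derive; rewrite /GRing.scale/= /dy2.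
  move: q0; rewrite /quad => q0.
  by field.
pose F (u : R) : R := Num.sqrt (y2 u).
pose F' (u : R) : R := dy2 u / (2 * F u).
have F_gt0 (u : R) : 0 < u < 1 -> 0 < F u by move=> /y2_gt0; rewrite sqrtr_gt0.
have dF (u : R) : 0 < u < 1 -> is_derive u 1 F (F' u).
  move=> u01; have y20 := y2_gt0 _ u01.
  have dc := is_derive1_comp (is_derive1_sqrt y20) (dy2P _ u01).
  by apply: (is_derive_eq dc); rewrite mulrC.
have dy2_gt0 (u : R) : 0 < u < 1 -> 0 < dy2 u.
  move=> /andP[u0 u1]; rewrite divr_gt0//.
    rewrite mulr_gt0// BB// expr_le1 ?subr_ge0 ?gerBl ?(ltW u0) ?(ltW u1)//.
  by rewrite exprn_gt0// qu0// (ltW u0) (ltW u1).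
have F0 : F 0 = 0 by rewrite /F y2E ?lexx ?ler01// !mul0r sqrtr0.
have F1 : F 1 = 1 by rewrite /F /y2 subrr mulr0 mul0r subr0 sqrtr1.
(* 1 - k^2 = q_e(1) / q_e'(1) *)
have k1 : k ^+ 2 < 1.
  rewrite -(ltr_pM2r S'0) kE mul1r -subr_gt0.
  have -> : quad B e' 1 - B * (e - e') = quad B e 1 by rewrite /quad; ring.
  by [].
have arg_gt0 (y : R) : 0 < y < 1 -> 0 < (1 - y ^+ 2) * (1 - k ^+ 2 * y ^+ 2).
  move=> /andP[y0 y1]; have y21 : y ^+ 2 < 1 by rewrite expr_lt1// ltW.
  rewrite mulr_gt0 ?subr_gt0//; apply: le_lt_trans k1.
  by rewrite ler_piMr ?sqr_ge0// ltW.
have -> : `]0%R, 1%R[ = `](F 0)%R, (F 1)%R[ :> set R by rewrite F0 F1.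
rewrite (ge0_integration_by_substitution_oo F _ _ 0 1 ltr01 _ dF)//.
- rewrite F0 F1; apply: eq_integral => u; rewrite inE/= in_itv/= => u01.
  congr (EFin _).
  have [u0 u1] := andP u01.
  have uu : 0 <= u <= 1 by rewrite !ltW.
  have v0 : 0 < 1 - u by rewrite subr_gt0.
  have y20 := y2_gt0 _ u01; have q0 := qu0 _ uu; have q'0 := q'u0 _ uu.
  have d0 : 0 < B ^+ 2 - (1 - u) by rewrite BB// gerBl ltW.
  rewrite /F' /F sqr_sqrtr ?(ltW y20)//.
  have -> : 1 - y2 u = quad B e 1 * (1 - u) / quad B e (1 - u) by rewrite /y2; ring.
  have -> : 1 - k ^+ 2 * y2 u =
      quad B e 1 * quad B e' (1 - u) / (quad B e' 1 * quad B e (1 - u)).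
    rewrite -[k ^+ 2](mulfK (lt0r_neq0 S'0)) kE y2E//.
    have -> : quad B e 1 * quad B e' (1 - u) = quad B e' 1 * quad B e (1 - u) -
        B * (e - e') * (u * (B ^+ 2 - (1 - u))) by rewrite /quad; ring.
    by field; rewrite !lt0r_neq0.
  rewrite y2E// /arcsine_weight /elliptic_kernel /dy2.
  exact: elliptic_jacobian.
- by apply: continuous_in_subspaceT => u; rewrite inE/= in_itv/= => /y2c y2cu;
    apply: (continuous_comp y2cu); exact: sqrt_continuous.
- move=> u u01; apply: cvgM.
    apply: cvgM.
      apply: cvgM; first exact: cvg_cst.
      by apply: cvgB; [exact: cvg_cst|exact: onem_sqr_continuous].
    have q0 : 0 < quad B e (1 - u).
      by move: u01 => /andP[u0 u1]; rewrite qu0// !ltW.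
    apply: cvgV; first by rewrite lt0r_neq0// exprn_gt0.
    apply: (@continuous_comp _ _ _ (fun u : R => quad B e (1 - u)) (fun v => v ^+ 2)).
      exact: quad_onem_continuous.
    exact: exprn_continuous.
  apply: cvgV; first by rewrite mulf_neq0// lt0r_neq0// F_gt0.
  by apply: cvgM; [exact: cvg_cst|exact: is_derive1_continuous (dF _ u01)].
- move=> u u01; apply: divr_gt0; first exact: dy2_gt0.
  by rewrite mulr_gt0// F_gt0.
- rewrite F0 F1 => y /arg_gt0 y0.
  apply: cvgV; first by rewrite lt0r_neq0// sqrtr_gt0.
  apply: continuous_comp; last exact: sqrt_continuous.
  apply: cvgM; first by apply: cvgB; [exact: cvg_cst|exact: exprn_continuous].
  apply: cvgB; first exact: cvg_cst.
  by apply: cvgM; [exact: cvg_cst|exact: exprn_continuous].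
Qed.

End EllipticK.

(** * Two elliptic integrals add up to a hyperelliptic one *)

Section RealIdentity.
Local Open Scope classical_set_scope.
Context {R : realType}.
Notation mu := (@lebesgue_measure R).

Lemma integrableZ (D : set R) (mD : measurable D) (f : R -> R) (r : R) :
  mu.-integrable D (EFin \o f) -> mu.-integrable D (EFin \o (fun x => r * f x)).
Proof.
move=> fi.
apply: (@eq_integrable _ (measurableTypeR R) _ _ _ _
  (fun x => r%:E * (f x)%:E)%E) => //.
by apply: integrableZl.
Qed.

Lemma arcsine_weight_mul_measurable (g : R -> R) :
  (forall u, 0 <= u <= 1 -> {for u, continuous g}) ->
  measurable_fun (`]0, 1[ : set R) (fun u => arcsine_weight u * g u).
Proof.
move=> cg; apply: open_continuous_measurable_fun => // u.
rewrite inE/= in_itv/= => u01; apply: cvgM; first exact: arcsine_weight_continuous.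
by apply: cg; case/andP: u01 => u0 u1; rewrite !ltW.
Qed.

(** A continuous function on a segment is bounded, and the weight is
    integrable. *)
Lemma integrable_arcsine_mul (g : R -> R) :
  (forall u, 0 <= u <= 1 -> {for u, continuous g}) ->
  mu.-integrable `]0, 1[ (EFin \o (fun u => arcsine_weight u * g u)).
Proof.
move=> cg.
have cng : {within `[0, 1], continuous (fun u => `|g u|)}.
  apply: continuous_in_subspaceT => u; rewrite inE/= in_itv/= => /cg cgu.
  by apply: (continuous_comp cgu); exact: norm_continuous.
have [c _ gc] := EVT_max ler01 cng.
apply: (le_integrable _ _ _ (integrableZ _ _ _ `|g c| integrable_arcsine_weight)) => //.
  by apply/measurable_EFinP; exact: arcsine_weight_mul_measurable.
move=> u; rewrite /= in_itv/= => /andP[u0 u1].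
rewrite lee_fin !normrM normr_id mulrC ler_wpM2r ?normr_ge0// gc//.
by rewrite in_itv/= !ltW.
Qed.

(** The minimum of [g] is positive, and the weight has integral pi. *)
Lemma Rintegral_arcsine_mul_gt0 (g : R -> R) :
  (forall u, 0 <= u <= 1 -> {for u, continuous g}) ->
  (forall u, 0 <= u <= 1 -> 0 < g u) ->
  0 < \int[mu]_(u in `]0, 1[) (arcsine_weight u * g u).
Proof.
move=> cg g0.
have cng : {within `[0, 1], continuous g}.
  by apply: continuous_in_subspaceT => u; rewrite inE/= in_itv/= => /cg.
have [c c01 gc] := EVT_min ler01 cng.
apply: (@lt_le_trans _ _ (g c * pi)).
  by rewrite mulr_gt0 ?pi_gt0// g0//; move: c01; rewrite in_itv.
have -> : g c * pi = \int[mu]_(u in `]0, 1[) (g c * arcsine_weight u).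
  rewrite RintegralZl//; last exact: integrable_arcsine_weight.
  congr (_ * _).
  have := integral_arcsine_moment (R := R) 0.
  rewrite /central_coef big_ord0 mulr1 => /(congr1 fine) /= <-.
  by congr fine; apply: eq_integral => u _; rewrite expr0 mulr1.
apply: le_Rintegral => //.
- exact: integrableZ integrable_arcsine_weight.
- exact: integrable_arcsine_mul.
- move=> u; rewrite /= in_itv/= => /andP[u0 u1].
  by rewrite mulrC ler_wpM2l ?arcsine_weight_ge0// gc// in_itv/= !ltW.
Qed.

Lemma elliptic_kernel_continuous (B e e' : R) : 1 < B -> e <= 2 -> e' <= 2 ->
  forall u, 0 <= u <= 1 -> {for u, continuous (elliptic_kernel B e e')}.
Proof.
move=> B1 e2 e'2 u /andP[u0 u1].
have u'01 : 0 <= 1 - u <= 1 by rewrite subr_ge0 u1 gerBl.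
apply: cvgM.
  by apply: cvgB; [exact: cvg_cst|exact: onem_sqr_continuous].
have d0 : 0 < (B ^+ 2 - (1 - u)) * (quad B e (1 - u) * quad B e' (1 - u)).
  rewrite !mulr_gt0 ?quad_gt0// subr_gt0 (le_lt_trans (_ : _ <= 1))//.
    by case/andP: u'01.
  by rewrite expr_gt1// ltW// (lt_trans ltr01).
apply: cvgV; first by rewrite lt0r_neq0// mulr_gt0// sqrtr_gt0.
apply: cvgM; first exact: cvg_cst.
apply: continuous_comp; last exact: sqrt_continuous.
apply: cvgM; first by apply: cvgB; [exact: cvg_cst|exact: onem_continuous].
by apply: cvgM; exact: quad_onem_continuous.
Qed.

Lemma ellipticK_kernel (B e e' k : R) :
  1 < B -> e <= 2 -> e' <= 2 -> k ^+ 2 * quad B e' 1 = B * (e - e') ->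
  ellipticK k / Num.sqrt (quad B e' 1) =
  \int[mu]_(u in `]0, 1[) (arcsine_weight u * elliptic_kernel B e e' u).
Proof.
move=> B1 e2 e'2 kE.
have S'0 : 0 < quad B e' 1 by rewrite quad_gt0// ler01 lexx.
have -> : ellipticK k = \int[mu]_(u in `]0, 1[)
    (Num.sqrt (quad B e' 1) * (arcsine_weight u * elliptic_kernel B e e' u)).
  congr fine; rewrite (integral_ellipticK B e e')//.
  by apply: eq_integral => u _; rewrite mulrCA.
rewrite RintegralZl//; last first.
  by apply: integrable_arcsine_mul; exact: elliptic_kernel_continuous.
by rewrite mulrAC divff ?mul1r// lt0r_neq0// sqrtr_gt0.
Qed.

Definition hyperelliptic_kernel (B c u : R) : R :=
  B / Num.sqrt ((B ^+ 2 - (1 - u)) * quad B (2 * c) (1 - u)).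

Lemma hyperelliptic_radicand_gt0 (B c u : R) : 1 < B -> c <= 1 -> 0 <= u <= 1 ->
  0 < (B ^+ 2 - (1 - u)) * quad B (2 * c) (1 - u).
Proof.
move=> B1 c1 /andP[u0 u1].
have u'01 : 0 <= 1 - u <= 1 by rewrite subr_ge0 u1 gerBl.
rewrite mulr_gt0 ?quad_gt0 ?ler_piMr// subr_gt0 (le_lt_trans (_ : _ <= 1))//.
  by case/andP: u'01.
by rewrite expr_gt1// ltW// (lt_trans ltr01).
Qed.

(** q_2 and q_(-2) are squares, so the two kernels are the hyperelliptic one
    multiplied by (B + v) / (2 B) and by (B - v) / (2 B). *)
Lemma elliptic_kernelD (B c u : R) : 1 < B -> c <= 1 -> 0 <= u <= 1 ->
  elliptic_kernel B 2 (2 * c) u + elliptic_kernel B (2 * c) (- 2) u =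
  hyperelliptic_kernel B c u.
Proof.
move=> B1 c1 /andP[u0 u1]; rewrite /elliptic_kernel /hyperelliptic_kernel.
have [v0 v1] : 0 <= 1 - u /\ 1 - u <= 1 by rewrite subr_ge0 gerBl.
move: (1 - u) v0 v1 => v v0 v1 {u u0 u1}.
have Q0 : 0 < quad B (2 * c) v by rewrite quad_gt0 ?v0// ler_piMr.
have d0 : 0 < B ^+ 2 - v.
  by rewrite subr_gt0 (le_lt_trans v1)// expr_gt1// ltW// (lt_trans ltr01).
have BmV : 0 < B - v by rewrite subr_gt0 (le_lt_trans v1).
have BpV : 0 < B + v by rewrite ltr_wpDr// (lt_trans ltr01).
have -> : quad B 2 v = (B - v) ^+ 2 by rewrite /quad; ring.
have -> : quad B (- 2) v = (B + v) ^+ 2 by rewrite /quad; ring.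
have -> : (B ^+ 2 - v) * ((B - v) ^+ 2 * quad B (2 * c) v) =
    (B - v) ^+ 2 * ((B ^+ 2 - v) * quad B (2 * c) v) by ring.
have -> : (B ^+ 2 - v) * (quad B (2 * c) v * (B + v) ^+ 2) =
    (B + v) ^+ 2 * ((B ^+ 2 - v) * quad B (2 * c) v) by ring.
rewrite !(sqrtrM _ (sqr_ge0 _)) !sqrtr_sqr !gtr0_norm//.
have := mulr_gt0 d0 Q0; rewrite -sqrtr_gt0.
move: (Num.sqrt _) => r r0.
by field; rewrite !lt0r_neq0.
Qed.

Lemma hyperelliptic_kernel_continuous (B c : R) : 1 < B -> c <= 1 ->
  forall u, 0 <= u <= 1 -> {for u, continuous (hyperelliptic_kernel B c)}.
Proof.
move=> B1 c1 u /andP[u0 u1].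
have d0 := hyperelliptic_radicand_gt0 B c u B1 c1 (introT andP (conj u0 u1)).
apply: cvgM; first exact: cvg_cst.
apply: cvgV; first by rewrite lt0r_neq0// sqrtr_gt0.
apply: continuous_comp; last exact: sqrt_continuous.
apply: cvgM; last exact: quad_onem_continuous.
by apply: cvgB; [exact: cvg_cst|exact: onem_continuous].
Qed.

Lemma hyperelliptic_kernel_gt0 (B c u : R) : 1 < B -> c <= 1 -> 0 <= u <= 1 ->
  0 < hyperelliptic_kernel B c u.
Proof.
move=> B1 c1 u01; apply: divr_gt0; first exact: lt_trans ltr01 B1.
by rewrite sqrtr_gt0 hyperelliptic_radicand_gt0.
Qed.

Lemma ellipticK_sum (B c k1 k2 : R) : 1 < B -> c <= 1 ->
  k1 ^+ 2 * quad B (2 * c) 1 = 2 * B * (1 - c) ->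
  k2 ^+ 2 * (1 + B) ^+ 2 = 2 * B * (1 + c) ->
  ellipticK k1 / Num.sqrt (quad B (2 * c) 1) + ellipticK k2 / (1 + B) =
  \int[mu]_(u in `]0, 1[) (arcsine_weight u * hyperelliptic_kernel B c u).
Proof.
move=> B1 c1 k1E k2E.
have c2 : 2 * c <= 2 by rewrite ler_piMr.
have -> : 1 + B = Num.sqrt (quad B (- 2) 1).
  have -> : quad B (- 2) 1 = (1 + B) ^+ 2 by rewrite /quad; ring.
  by rewrite sqrtr_sqr gtr0_norm// addr_gt0// (lt_trans ltr01).
have n22 : -2 <= 2 :> R by lra.
rewrite (ellipticK_kernel B 2 (2 * c))//; last by rewrite k1E; ring.
rewrite (ellipticK_kernel B (2 * c) (- 2))//; last first.
  by rewrite (_ : quad B (- 2) 1 = (1 + B) ^+ 2) ?k2E /quad; ring.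
rewrite -RintegralD//; try by
  apply: integrable_arcsine_mul; exact: elliptic_kernel_continuous.
apply: eq_Rintegral => u; rewrite inE/= in_itv/= => /andP[u0 u1].
by rewrite -mulrDr elliptic_kernelD// !ltW.
Qed.

End RealIdentity.

(** * Values of the Gamma function *)

Section ComplexPart.
Local Open Scope classical_set_scope.
Context {R : realType}.
Notation mu := (@lebesgue_measure R).

Lemma cintegral_real (D : set R) (f : R -> R[i]) (g : R -> R) :
  (forall x, D x -> f x = (g x)%:C) ->
  cintegral D f = (\int[mu]_(x in D) g x)%:C.
Proof.
move=> fg; rewrite /cintegral; congr Complex.
  by apply: eq_Rintegral => x; rewrite inE => /fg ->.
rewrite (@eq_Rintegral _ _ _ mu D (cst 0)); last by move=> x; rewrite inE => /fg ->.
by rewrite /Rintegral integral0.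
Qed.

Lemma normc_real (x : R) : 0 <= x -> Normc.normc x%:C = x.
Proof. by move=> x0; rewrite /= expr0n addr0 sqrtr_sqr ger0_norm. Qed.

Lemma carg_real (x : R) : 0 < x -> carg x%:C = 0.
Proof.
by move=> x0; rewrite /carg lexx normc_real ?ltW//= divff ?lt0r_neq0// acos1.
Qed.

Lemma cpow_real (x s : R) : 0 < x -> cpow x%:C s%:C = (x `^ s)%:C.
Proof.
move=> x0; rewrite /cpow /clog carg_real// normc_real ?ltW//.
rewrite /cexp -[ln x +i* 0]/(ln x)%:C -rmorphM/= cos0 sin0.
by rewrite -[1 +i* 0]/(1%:C) mulr1 /powR gt_eqF.
Qed.

Lemma half_real : 2^-1 = (2^-1)%:C :> R[i].
Proof. by rewrite fmorphV rmorph_nat. Qed.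

Lemma cpow_half (x : R) : 0 < x -> cpow x%:C 2^-1 = (Num.sqrt x)%:C.
Proof. by move=> x0; rewrite half_real cpow_real// powR12_sqrt// ltW. Qed.

Lemma cpow_half_sub1 (x : R) : 0 < x ->
  cpow x%:C (2^-1 - 1) = (Num.sqrt x)^-1%:C.
Proof.
move=> x0; have -> : 2^-1 - 1 = (- 2^-1)%:C :> R[i].
  by rewrite half_real -(rmorph1 (real_complex R)) -rmorphB; congr (_%:C); field.
by rewrite cpow_real// powRN powR12_sqrt// ltW.
Qed.

Lemma is_derive_expRN (x : R) :
  is_derive x 1 (fun t : R => expR (- t)) (- expR (- x)).
Proof. by apply: trigger_derive; rewrite /GRing.scale/=; ring. Qed.

Lemma cGamma1 : cGamma (1 : R[i]) = 1.
Proof.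
rewrite /cGamma (cintegral_real _ _ (fun t => expR (- t))); last first.
  move=> t; rewrite /= in_itv/= andbT => t0.
  by rewrite subrr -[0]/(0%:C) cpow_real// powRr0 mul1r.
suff -> : \int[mu]_(t in `]0, +oo[) expR (- t) = 1 by [].
have cexpN (x : R) : {for x, continuous (fun t : R => expR (- t))}.
  exact: is_derive1_continuous (is_derive_expRN x).
have dexpN (x : R) : is_derive x 1 (fun t : R => - expR (- t)) (expR (- x)).
  by apply: (is_derive_eq (is_deriveN (is_derive_expRN x))); rewrite opprK.
rewrite /Rintegral integral_itv_obnd_cbnd; last first.
  by apply/measurable_EFinP; apply: measurableT_comp.
rewrite (@ge0_continuous_FTC2y _ _ (fun x => - (expR (- x))) _ 0)//.
- by rewrite oppr0 expR0 EFinN oppeK add0e.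
- by apply: continuous_subspaceT => x; exact: cexpN.
- by rewrite -oppr0; apply: cvgN; exact: cvgr_expR.
- by apply: cvgN; apply: cvg_at_right_filter; exact: cexpN.
- by move=> x _; rewrite derive1E; case: (dexpN x).
Qed.

(** t = s^2 turns the integral into the Gaussian one. The change of variables
    is made on bounded intervals, which then exhaust the half-line. *)
Lemma cGamma_half : cGamma (2^-1 : R[i]) = (Num.sqrt pi)%:C.
Proof.
pose G (t : R) : R := (Num.sqrt t)^-1 * expR (- t).
rewrite /cGamma (cintegral_real _ _ G); last first.
  move=> t; rewrite /= in_itv/= andbT => t0.
  by rewrite cpow_half_sub1// rmorphM.
congr (_%:C).
have itv0y (a : R^nat) : (forall n, n%:R <= a n) ->
    `]0, +oo[ = \bigcup_n `]0, a n[%classic.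
  move=> na; apply/seteqP; split=> [x|x [n _]] /=;
    rewrite !in_itv/= ?andbT; last by case/andP.
  move=> x0; exists (Num.bound x) => //=; rewrite in_itv/= x0/=.
  by apply: lt_le_trans (na _); apply: archi_boundP; exact: ltW.
have ndI (a : R^nat) : (forall n m, (n <= m)%N -> a n <= a m) ->
    nondecreasing_seq (fun n => `]0, a n[%classic).
  move=> nda n m nm; apply/subsetPset => x /=; rewrite !in_itv/= => /andP[->/=].
  by move/lt_le_trans; apply; exact: nda.
pose a_ (n : nat) : R := n.+1%:R.
have a_gt0 n : 0 < a_ n by [].
have a_S n m : (n <= m)%N -> a_ n <= a_ m by move=> nm; rewrite ler_nat.
have a2_S n m : (n <= m)%N -> a_ n ^+ 2 <= a_ m ^+ 2.
  by move=> /a_S; apply: lerXn2r; rewrite nnegrE ltW.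
have le_a n : n%:R <= a_ n by rewrite ler_nat.
have le_a2 n : n%:R <= a_ n ^+ 2.
  by rewrite (le_trans (le_a n))// expr2; apply: ler_peMr; rewrite ?ler1n// ltW.
have dF (x : R) : is_derive x 1 (fun s : R => s ^+ 2) (2 * x).
  by apply: trigger_derive; rewrite /GRing.scale/=; ring.
have cG (t : R) : 0 < t -> {for t, continuous G}.
  move=> t0; apply: cvgM; last exact: is_derive1_continuous (is_derive_expRN t).
  by apply: cvgV; [rewrite lt0r_neq0// sqrtr_gt0|exact: sqrt_continuous].
have G0 t : 0 <= G t by rewrite mulr_ge0 ?invr_ge0 ?sqrtr_ge0 ?expR_ge0.
have seg n : (\int[mu]_(s in `]0%R, a_ n[) (2 * gauss_fun s)%:E =
    \int[mu]_(t in `]0%R, (a_ n ^+ 2)%R[) (G t)%:E)%E.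
  have -> : `]0%R, (a_ n ^+ 2)%R[ = `](0 ^+ 2)%R, (a_ n ^+ 2)%R[ :> set R.
    by rewrite expr0n.
  rewrite (ge0_integration_by_substitution_oo _ _ G 0 (a_ n) (a_gt0 n) _
    (fun x _ => dF x))//.
  - apply: eq_integral => s; rewrite inE/= in_itv/= => /andP[s0 _].
    rewrite /G sqrtr_sqr gtr0_norm// /gauss_fun; congr (_%:E).
    by field; rewrite lt0r_neq0.
  - by apply: continuous_subspaceT; exact: exprn_continuous.
  - by move=> s _; apply: cvgM; [exact: cvg_cst|exact: cvg_id].
  - by move=> s /andP[s0 _]; rewrite mulr_gt0.
  - by move=> t; rewrite expr0n/= => /andP[t0 _]; exact: cG.
have gm : measurable_fun setT (fun s : R => 2 * gauss_fun s).
  by apply: measurable_funM => //; exact: measurable_gauss_fun.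
have := ge0_integral_exhaustion _ _ _ _ _ _
  (ndI _ a_S) (ndI _ a2_S) _ _ _ _ seg.
rewrite -!itv0y// => /(_ _ _ _ _ _ _)/= H.
rewrite /Rintegral -H//.
- rewrite integral_itv_obnd_cbnd; last first.
    by apply/measurable_EFinP; exact: measurable_funS gm.
  under eq_integral do rewrite EFinM.
  rewrite ge0_integralZl//.
  + by rewrite integral0y_gauss -EFinM /= mulrC divfK.
  + by apply/measurable_EFinP; apply: measurable_funS (@measurable_gauss_fun R).
  + by move=> s _; rewrite lee_fin gauss_fun_ge0.
- by move=> n; apply/measurable_EFinP; exact: measurable_funS gm.
- move=> n; apply/measurable_EFinP; apply: open_continuous_measurable_fun => // t.
  by rewrite inE/= in_itv/= => /andP[t0 _]; exact: cG.
- by move=> n s _; rewrite lee_fin mulr_ge0// gauss_fun_ge0.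
- by move=> n t _; rewrite lee_fin.
Qed.

End ComplexPart.

(** * The Lauricella function as an Euler integral *)

Section IntegralRepresentation.
Local Open Scope classical_set_scope.
Context {R : realType}.
Notation mu := (@lebesgue_measure R).

Lemma normc_conj (z : R[i]) : Normc.normc (conjc z) = Normc.normc z.
Proof. by case: z => x y /=; rewrite sqrrN. Qed.

(** The principal argument is odd under conjugation off the negative real
    axis, where both conjugates would get the argument pi. *)
Lemma carg_conj (z : R[i]) : complex.Im z != 0 \/ 0 < complex.Re z ->
  carg (conjc z) = - carg z.
Proof.
have [y0 [/eqP//|x0]|y0 _] := eqVneq (complex.Im z) 0.
  case: z y0 x0 => x y /= -> x0.
  by rewrite oppr0 -[x +i* 0]/(x%:C) carg_real// oppr0.
rewrite /carg normc_conj; case: z y0 => x y /=; rewrite oppr_ge0.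
by case: (ltgtP 0 y) => //= _ _; rewrite opprK.
Qed.

Lemma cpow_halfE (z : R[i]) : z != 0 -> cpow z 2^-1 =
  (Num.sqrt (Normc.normc z))%:C * (cos (carg z / 2) +i* sin (carg z / 2)).
Proof.
move=> z0; have n0 : 0 < Normc.normc z.
  rewrite lt0r; apply/andP; split; last by case: (z) => x y; exact: sqrtr_ge0.
  by apply: contra z0 => /eqP/Normc.eq0_normc ->.
rewrite /cpow /clog half_real /cexp /= !mul0r subr0 addr0.
by rewrite -powR12_sqrt ?ltW// /powR gt_eqF// [2^-1 * carg z]mulrC.
Qed.

(** The half-arguments of conjugate numbers are opposite. *)
Lemma cpow_half_mul_conj (z : R[i]) : complex.Im z != 0 \/ 0 < complex.Re z ->
  cpow z 2^-1 * cpow (conjc z) 2^-1 = (Normc.normc z)%:C.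
Proof.
move=> z0.
have zn0 : z != 0 by case: z0 => [|/lt0r_neq0]; apply: contra => /eqP ->.
rewrite !cpow_halfE//; last by rewrite conjc_eq0.
rewrite carg_conj// normc_conj mulNr cosN sinN.
rewrite mulrACA -rmorphM -expr2 sqr_sqrtr; last first.
  by case: (z) => x y; exact: sqrtr_ge0.
rewrite -[RHS]mulr1; congr (_ * _); apply/eqP; rewrite eq_complex /=.
rewrite mulrN opprK -!expr2 cos2Dsin2 eqxx/=.
by rewrite mulrN mulrC addNr.
Qed.

Lemma mulr_segment_lt1 (x u : R) : x < 1 -> 0 <= u <= 1 -> x * u < 1.
Proof.
move=> x1 /andP[u0 u1]; have [x0|x0] := lerP x 0.
  by rewrite (le_lt_trans _ ltr01)// mulr_le0_ge0.
by rewrite (le_lt_trans _ x1)// ler_piMr// ltW.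
Qed.

(** The principal square root of 1 - z u is only evaluated off the cut. *)
Lemma onem_mul_segment_slit (z : R[i]) (u : R) :
  complex.Im z != 0 \/ complex.Re z < 1 -> 0 <= u <= 1 ->
  complex.Im (1 - z * u%:C) != 0 \/ 0 < complex.Re (1 - z * u%:C).
Proof.
case: z => p q /= z1 u01; rewrite !mulr0 subr0 !add0r.
have [->|u0] := eqVneq u 0; first by right; rewrite mulr0 subr0.
case: z1 => [q0|p1]; first by left; rewrite oppr_eq0 mulf_neq0.
by right; rewrite subr_gt0 mulr_segment_lt1.
Qed.

(** The Euler integrand at the variables x, z and the conjugate of z, without
    the arcsine weight. *)
Definition lauricella_integrand (x : R) (z : R[i]) (u : R) : R :=
  (Num.sqrt (1 - x * u) * Normc.normc (1 - z * u%:C))^-1.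

Lemma lauricellaD_integralE (x : R) (z : R[i]) : x < 1 ->
  complex.Im z != 0 \/ complex.Re z < 1 ->
  lauricellaD_integral (2^-1 : R[i]) [tuple 2^-1; 2^-1; 2^-1] 1
    [tuple x%:C; z; conjc z] =
  (pi^-1 * \int[mu]_(u in `]0, 1[)
             (arcsine_weight u * lauricella_integrand x z u))%:C.
Proof.
move=> x1 z1.
have half_half : 1 - 2^-1 = 2^-1 :> R[i].
  by rewrite half_real -(rmorph1 (real_complex R)) -rmorphB; congr (_%:C); field.
rewrite /lauricellaD_integral half_half cGamma1 cGamma_half.
rewrite rmorphM; congr (_ * _).
  by rewrite -rmorphM -expr2 sqr_sqrtr ?pi_ge0// div1r -fmorphV.
apply: cintegral_real => u; rewrite /= in_itv/= => /andP[u0 u1].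
rewrite !big_ord_recl big_ord0 mulr1 !(tnth_nth 0)/=.
have -> : 1 - x%:C * u%:C = (1 - x * u)%:C.
  by rewrite rmorphB rmorphM rmorph1.
have -> : 1 - conjc z * u%:C = conjc (1 - z * u%:C).
  case: (z) => p q; apply/eqP; rewrite eq_complex/=.
  by apply/andP; split; apply/eqP; ring.
rewrite !cpow_half_sub1 ?subr_gt0// cpow_half; last first.
  by rewrite subr_gt0 mulr_segment_lt1// !ltW.
rewrite cpow_half_mul_conj; last first.
  by apply: onem_mul_segment_slit; rewrite ?ltW.
rewrite /arcsine_weight /lauricella_integrand sqrtrM ?(ltW u0)//.
rewrite [X in _ = (X * _)%:C]invfM.
by rewrite !rmorphM/= !fmorphV/= !rmorphM.
Qed.

End IntegralRepresentation.

(** * Truncations of the series of (1 - w)^(-1/2) *)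

Section InverseSqrtSeries.
Context {F : numFieldType}.
Implicit Types (w : F).

Lemma central_coef_ge0 n : 0 <= central_coef n :> F.
Proof.
by rewrite prodr_ge0// => j _; rewrite divr_ge0// addr_ge0// invr_ge0.
Qed.

Lemma central_coefS_le n : central_coef n.+1 <= central_coef n :> F.
Proof.
rewrite central_coefS ler_piMr ?central_coef_ge0// ler_pdivrMr// mul1r.
by rewrite -[n.+1%:R]nat1r lerD2r invf_le1// ler1n.
Qed.

Lemma central_coef_le1 n : central_coef n <= 1 :> F.
Proof.
elim: n => [|n IH]; first by rewrite /central_coef big_ord0.
exact: le_trans (central_coefS_le n) IH.
Qed.

Lemma central_coef_recl n :
  n.+1%:R * central_coef n.+1 = (2^-1 + n%:R) * central_coef n :> F.
Proof. by rewrite central_coefS; field; rewrite nat1r pnatr_eq0. Qed.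

(** The generating function of c is (1 - w)^(-1/2), whose square is 1 / (1 -
    w). Algebraically: weighting the sum S_n by the index i gives n S_n / 2
    by the symmetry between i and n - i, while the recurrence of c turns the
    weighted sum at n + 1 into (n + 1) S_n / 2; hence S_(n+1) = S_n. *)
Lemma central_coef_convolution n :
  \sum_(i < n.+1) central_coef i * central_coef (n - i) = 1 :> F.
Proof.
pose S n : F := \sum_(i < n.+1) central_coef i * central_coef (n - i).
pose T n : F := \sum_(i < n.+1) i%:R * central_coef i * central_coef (n - i).
have TS m : 2 * T m = m%:R * S m.
  have Trev : T m = \sum_(i < m.+1) (m - i)%:R * central_coef i * central_coef (m - i).
    rewrite /T (reindex_inj rev_ord_inj)/=; apply: eq_bigr => i _.
    have im : (i <= m)%N by rewrite -ltnS.
    by rewrite subSS subKn// mulrAC.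
  rewrite mulr2n mulrDl mul1r {2}Trev -big_split/= mulr_sumr.
  apply: eq_bigr => i _; have im : (i <= m)%N by rewrite -ltnS.
  by rewrite -!mulrDl -natrD subnKC// mulrA.
(* the term i = 0 of T vanishes, and (i + 1) c_(i+1) = (i + 1/2) c_i *)
have TSS m : T m.+1 = T m + 2^-1 * S m.
  rewrite /T big_ord_recl !mul0r add0r mulr_sumr -big_split/=.
  apply: eq_bigr => i _; rewrite /bump/= add1n subSS central_coef_recl.
  by ring.
have SS m : S m.+1 = S m.
  have /mulfI : m.+1%:R != 0 :> F by rewrite pnatr_eq0.
  apply; rewrite -TS TSS mulrDr TS mulVKf ?pnatr_eq0//.
  by rewrite -[m.+1%:R]natr1 mulrDl mul1r.
rewrite -/(S n); elim: n => [|n]; last by rewrite SS.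
by rewrite /S big_ord_recl big_ord0 addr0 /central_coef !big_ord0 mulr1.
Qed.

Definition inv_sqrt_poly N : {poly F} := \poly_(k < N) central_coef k.

Lemma inv_sqrt_polyE N w :
  (inv_sqrt_poly N).[w] = \sum_(k < N) central_coef k * w ^+ k.
Proof. by rewrite horner_poly. Qed.

Lemma sqr_inv_sqrt_poly_coef N n : (n < N)%N -> (inv_sqrt_poly N ^+ 2)`_n = 1.
Proof.
move=> nN; rewrite expr2 coefM -[RHS](central_coef_convolution n).
apply: eq_bigr => i _; rewrite !coef_poly.
have iN : (i <= n)%N by rewrite -ltnS.
by rewrite (leq_ltn_trans (leq_subr _ _) nN) (leq_ltn_trans iN nN).
Qed.

Lemma sqr_inv_sqrt_poly_coef_bound N n : `|(inv_sqrt_poly N ^+ 2)`_n| <= 1.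
Proof.
rewrite expr2 coefM -[leRHS](central_coef_convolution n) ger0_norm; last first.
  apply: sumr_ge0 => i _; rewrite !coef_poly.
  by rewrite mulr_ge0//; case: ifP => _ //; exact: central_coef_ge0.
apply: ler_sum => i _; rewrite !coef_poly.
by apply: ler_pM; case: ifP => _ //; exact: central_coef_ge0.
Qed.

(** The square of the truncation has coefficient 1 below degree N and
    coefficients of modulus at most 1 from there on; multiplying by 1 - w
    telescopes the first part to 1 - w^N, and the rest has the factor w^N. *)
Lemma sqr_inv_sqrt_poly_bound N w :
  `|(inv_sqrt_poly N).[w] ^+ 2 * (1 - w) - 1| <=
  `|w| ^+ N * (1 + `|1 - w| * \sum_(k < N) `|w| ^+ k).
Proof.
pose d n := (inv_sqrt_poly N ^+ 2)`_n.
have -> : (inv_sqrt_poly N).[w] ^+ 2 =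
    \sum_(k < N) w ^+ k + w ^+ N * \sum_(k < N) d (N + k)%N * w ^+ k.
  rewrite -horner_exp (@horner_coef_wide _ (N + N)); last first.
    rewrite (leq_trans (size_polyMleq _ _))// (leq_trans (leq_pred _))//.
    by rewrite leq_add// size_poly.
  rewrite big_split_ord/= mulr_sumr; congr (_ + _); apply: eq_bigr => i _.
    by rewrite sqr_inv_sqrt_poly_coef// mul1r.
  by rewrite exprD mulrCA.
have gs : \sum_(k < N) w ^+ k * (1 - w) = 1 - w ^+ N.
  by rewrite -mulr_suml mulrC -opprB mulNr -subrX1 opprB.
have -> : (\sum_(k < N) w ^+ k +
      w ^+ N * \sum_(k < N) d (N + k)%N * w ^+ k) * (1 - w) - 1 =
    w ^+ N * ((1 - w) * \sum_(k < N) d (N + k)%N * w ^+ k - 1).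
  by rewrite mulrDl mulr_suml gs; ring.
rewrite normrM normrX ler_wpM2l ?exprn_ge0//.
rewrite (le_trans (ler_normB _ _))// normr1 addrC lerD2l normrM ler_wpM2l//.
rewrite (le_trans (ler_norm_sum _ _ _))//; apply: ler_sum => k _.
by rewrite normrM normrX ler_piMl ?exprn_ge0// sqr_inv_sqrt_poly_coef_bound.
Qed.

Lemma geometric_sum_le (r : F) N : 0 <= r < 1 ->
  \sum_(k < N) r ^+ k <= (1 - r)^-1.
Proof.
move=> /andP[r0 r1]; have r1' : 0 < 1 - r by rewrite subr_gt0.
rewrite -[leRHS]mul1r ler_pdivlMr// mulrC.
have -> : (1 - r) * \sum_(k < N) r ^+ k = 1 - r ^+ N.
  by rewrite -opprB mulNr -subrX1 opprB.
by rewrite gerBl exprn_ge0.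
Qed.

Lemma inv_sqrt_poly_bound N w r : `|w| <= r -> r < 1 ->
  `|(inv_sqrt_poly N).[w]| <= (1 - r)^-1.
Proof.
move=> wr r1; have r0 := le_trans (normr_ge0 w) wr.
apply: le_trans (geometric_sum_le r N _); last by rewrite r0.
rewrite inv_sqrt_polyE (le_trans (ler_norm_sum _ _ _))//; apply: ler_sum => k _.
rewrite normrM normrX ger0_norm ?central_coef_ge0//.
rewrite -[leRHS]mul1r; apply: ler_pM => //; rewrite ?central_coef_ge0 ?exprn_ge0//.
  exact: central_coef_le1.
by rewrite lerXn2r.
Qed.

End InverseSqrtSeries.

(** * Partial sums of the Lauricella series *)

Section Series.
Context {R : realType}.
Notation mu := (@lebesgue_measure R).

Lemma inv_sqrt_error_cvg0 (r C : R) : 0 <= r < 1 ->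
  r ^+ N * (1 + C * \sum_(k < N) r ^+ k) @[N --> \oo] --> (0 : R).
Proof.
move=> /andP[r0 r1].
have rN : r ^+ N @[N --> \oo] --> (0 : R) by apply: cvg_expr; rewrite ger0_norm.
have gs : \sum_(k < N) r ^+ k @[N --> \oo] --> (1 - r)^-1.
  have := @cvg_geometric_series R 1 r; rewrite ger0_norm// mul1r => /(_ r1).
  apply: cvg_trans; apply: near_eq_cvg; near=> N.
  by rewrite /series/= big_mkord; apply: eq_bigr => i _; rewrite mul1r.
rewrite -[X in _ --> X](mul0r (1 + C * (1 - r)^-1)).
apply: cvgM => //; apply: cvgD; first exact: cvg_cst.
by apply: cvgM => //; exact: cvg_cst.
Unshelve. all: by end_near. Qed.

Lemma cvg1_of_error (a e : R^nat) : (forall N, `|a N - 1| <= e N) ->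
  e @ \oo --> (0 : R) -> a @ \oo --> (1 : R).
Proof.
move=> ae e0; apply/subr_cvg0.
apply: (squeeze_cvgr (f := fun N => - e N) (h := e)) => //.
  by apply: nearW => N; rewrite -ler_norml.
by rewrite -oppr0; apply: cvgN.
Qed.

(** Consecutive terms are paired: c_2k x^2k + c_(2k+1) x^(2k+1) is
    nonnegative because c decreases and |x| < 1. *)
Lemma inv_sqrt_poly_ge0 (x : R) N : `|x| < 1 -> 0 <= (inv_sqrt_poly N).[x].
Proof.
move=> x1; have pS n : (inv_sqrt_poly n.+1).[x] =
    (inv_sqrt_poly n).[x] + central_coef n * x ^+ n.
  by rewrite !inv_sqrt_polyE big_ord_recr.
have even_ge0 n : 0 <= (inv_sqrt_poly n.*2).[x].
  elim: n => [|n IH]; first by rewrite inv_sqrt_polyE big_ord0.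
  rewrite doubleS !pS -addrA addr_ge0// exprS mulrA -mulrDl.
  rewrite mulr_ge0//; last by rewrite -mul2n exprM exprn_ge0// sqr_ge0.
  rewrite addrC -lerBlDr sub0r.
  apply: (@le_trans _ _ (- central_coef n.*2.+1)).
    by rewrite lerN2 central_coefS_le.
  rewrite -mulrN1 ler_wpM2l ?central_coef_ge0//.
  by move: (ltW x1); rewrite ler_norml => /andP[].
rewrite -(odd_double_half N); case: (odd N) => /=; last by rewrite add0n.
rewrite add1n pS addr_ge0// mulr_ge0 ?central_coef_ge0//.
by rewrite -mul2n exprM exprn_ge0// sqr_ge0.
Qed.

(** The square is controlled by [sqr_inv_sqrt_poly_bound]; the sign of the
    truncations selects the positive root. *)
Lemma inv_sqrt_poly_cvg (x : R) : `|x| < 1 ->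
  (inv_sqrt_poly N).[x] @[N --> \oo] --> (Num.sqrt (1 - x))^-1.
Proof.
move=> x1; have x0 : 0 < 1 - x by rewrite subr_gt0 (le_lt_trans (ler_norm x)).
have s0 : 0 < Num.sqrt (1 - x) by rewrite sqrtr_gt0.
have c1 : (inv_sqrt_poly N).[x] ^+ 2 * (1 - x) @[N --> \oo] --> (1 : R).
  apply: (cvg1_of_error _ _ (fun N => sqr_inv_sqrt_poly_bound N x)).
  by apply: inv_sqrt_error_cvg0; rewrite normr_ge0.
have cs : Num.sqrt ((inv_sqrt_poly N).[x] ^+ 2 * (1 - x)) @[N --> \oo] --> (1 : R).
  by rewrite -[X in _ --> X]sqrtr1; apply: continuous_cvg c1; exact: sqrt_continuous.
rewrite -[X in _ --> X]mul1r (_ : (fun N => _) = (fun N =>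
    Num.sqrt ((inv_sqrt_poly N).[x] ^+ 2 * (1 - x)) * (Num.sqrt (1 - x))^-1)).
  by apply: cvgM => //; exact: cvg_cst.
apply/funext => N.
rewrite sqrtrM ?sqr_ge0// sqrtr_sqr ger0_norm ?inv_sqrt_poly_ge0//.
by rewrite mulfK// lt0r_neq0.
Qed.

Lemma norm_normc (z : R[i]) : `|z| = (Normc.normc z)%:C.
Proof. by []. Qed.

Lemma normc_ge0 (z : R[i]) : 0 <= Normc.normc z.
Proof. by case: z => p q; exact: sqrtr_ge0. Qed.

Lemma sqr_normc_inv_sqrt_poly_cvg (z : R[i]) : Normc.normc z < 1 ->
  Normc.normc (inv_sqrt_poly N).[z] ^+ 2 @[N --> \oo] -->
  (Normc.normc (1 - z))^-1.
Proof.
move=> z1.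
have s0 : Normc.normc (1 - z) != 0.
  apply/eqP => /Normc.eq0_normc/eqP; rewrite subr_eq0 => /eqP zE.
  by move: z1; rewrite -zE Normc.normc1 ltxx.
have c1 : Normc.normc ((inv_sqrt_poly N).[z] ^+ 2 * (1 - z))
    @[N --> \oo] --> (1 : R).
  apply: (cvg1_of_error _ (fun N => Normc.normc z ^+ N *
      (1 + Normc.normc (1 - z) * \sum_(k < N) Normc.normc z ^+ k))).
    move=> N; set A := (_ * (1 - z)).
    apply: (@le_trans _ _ (Normc.normc (A - 1))).
      rewrite ler_norml; apply/andP; split.
        rewrite lerBrDr addrC lerBlDr -[leLHS]Normc.normc1.
        have := le_normcD A (1 - A); rewrite addrC subrK => /le_trans; apply.
        by rewrite lerD2l -normcN opprB.
      rewrite lerBlDr -[in leRHS]Normc.normc1.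
      by have := le_normcD (A - 1) 1; rewrite subrK.
    rewrite -lecR rmorphM rmorphXn rmorphD rmorphM rmorph1 rmorph_sum/=.
    under eq_bigr do rewrite rmorphXn.
    exact: sqr_inv_sqrt_poly_bound.
  by apply: inv_sqrt_error_cvg0; rewrite normc_ge0.
rewrite -[X in _ --> X]mul1r (_ : (fun N => _) = (fun N =>
    Normc.normc ((inv_sqrt_poly N).[z] ^+ 2 * (1 - z)) *
      (Normc.normc (1 - z))^-1)).
  by apply: cvgM => //; exact: cvg_cst.
apply/funext => N.
by rewrite Normc.normcM expr2 Normc.normcM -expr2 mulfK.
Qed.

Lemma integrable_lincomb (I : Type) (s : seq I) (D : set R) (mD : measurable D)
    (a : I -> R) (f : I -> R -> R) :
  (forall i, mu.-integrable D (EFin \o f i)) ->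
  mu.-integrable D (EFin \o (fun u => \sum_(i <- s) a i * f i u)) /\
  \int[mu]_(u in D) (\sum_(i <- s) a i * f i u) =
  \sum_(i <- s) a i * \int[mu]_(u in D) f i u.
Proof.
move=> fi; elim: s => [|i s [IHi IHe]].
  split.
    apply: (@eq_integrable _ (measurableTypeR R) _ _ _ _ (cst 0%E)) => //.
      by move=> u _; rewrite /= big_nil.
    exact: integrable0.
  rewrite big_nil; under eq_Rintegral do rewrite big_nil.
  by rewrite /Rintegral integral0.
have afi := integrableZ D mD (f i) (a i) (fi i).
split.
  apply: (@eq_integrable _ (measurableTypeR R) _ _ _ _
    (fun u => (a i * f i u)%:E + (\sum_(i <- s) a i * f i u)%:E)%E) => //.
    by move=> u _; rewrite /= big_cons EFinD.
  exact: integrableD.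
rewrite big_cons -IHe -RintegralZl// -RintegralD//.
by apply: eq_Rintegral => u _; rewrite big_cons.
Qed.

Lemma sum_mul_real (I : Type) (s : seq I) (p : I -> R[i]) (g : I -> R) :
  \sum_(i <- s) p i * (g i)%:C =
  (\sum_(i <- s) complex.Re (p i) * g i) +i* (\sum_(i <- s) complex.Im (p i) * g i).
Proof.
elim: s => [|i s IH]; first by rewrite !big_nil.
rewrite !big_cons IH; case: (p i) => a b; apply/eqP; rewrite eq_complex/=.
by rewrite !mulr0 subr0 add0r !eqxx.
Qed.

Lemma cintegral_lincomb (I : Type) (s : seq I) (D : set R) (mD : measurable D)
    (p : I -> R[i]) (f : I -> R -> R) :
  (forall i, mu.-integrable D (EFin \o f i)) ->
  cintegral D (fun u => \sum_(i <- s) p i * (f i u)%:C) =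
  \sum_(i <- s) p i * (\int[mu]_(u in D) f i u)%:C.
Proof.
move=> fi.
rewrite sum_mul_real /cintegral; congr Complex.
  rewrite -(integrable_lincomb _ s D mD (fun i => complex.Re (p i)) f fi).2.
  by apply: eq_Rintegral => u _; rewrite sum_mul_real.
rewrite -(integrable_lincomb _ s D mD (fun i => complex.Im (p i)) f fi).2.
by apply: eq_Rintegral => u _; rewrite sum_mul_real.
Qed.

Lemma pochhammer_half M :
  pochhammer (2^-1 : R[i]) M = central_coef M * M`!%:R.
Proof.
rewrite /pochhammer; elim: M => [|M IH].
  by rewrite !big_ord0 /central_coef big_ord0 mul1r.
rewrite big_ord_recr/= IH factS natrM mulrA [central_coef M.+1 * _]mulrC.
by rewrite central_coef_recl; ring.
Qed.

Lemma pochhammer_one M : pochhammer (1 : R[i]) M = M`!%:R.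
Proof.
rewrite /pochhammer; elim: M => [|M IH]; first by rewrite big_ord0.
by rewrite big_ord_recr/= IH nat1r -natrM mulnC -factS.
Qed.

(** For alpha = beta_j = 1/2 and gamma = 1 all Pochhammer quotients are
    coefficients of (1 - w)^(-1/2). *)
Lemma lauricellaD_term_half n (b x : n.-tuple R[i]) (m : 'I_n -> nat) :
  (forall j, tnth b j = 2^-1) ->
  lauricellaD_term 2^-1 b 1 x m =
  central_coef (\sum_j m j) * \prod_j (central_coef (m j) * tnth x j ^+ m j).
Proof.
move=> bE; rewrite /lauricellaD_term pochhammer_half pochhammer_one.
have -> : \prod_j pochhammer (tnth b j) (m j) =
    \prod_j (central_coef (m j) * (m j)`!%:R).
  by apply: eq_bigr => j _; rewrite bE pochhammer_half.
rewrite !big_split/=.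
have f0 k : k`!%:R != 0 :> R[i] by rewrite pnatr_eq0 -lt0n fact_gt0.
have p0 : \prod_j ((m j)`!%:R : R[i]) != 0 by apply/prodf_neq0.
by field; rewrite f0 p0.
Qed.

Lemma central_coef_real M : central_coef M = (central_coef M : R)%:C.
Proof.
rewrite /central_coef rmorph_prod; apply: eq_bigr => j _.
by rewrite rmorphM rmorphD fmorphV fmorphV !rmorph_nat.
Qed.

(** c_M is a moment of the arcsine weight, and inside the integral the n-fold
    sum over the cube factors. *)
Lemma lauricellaD_partial_sum n (b x : n.-tuple R[i]) N :
  (forall j, tnth b j = 2^-1) ->
  \sum_(m : {ffun 'I_n -> 'I_N}) lauricellaD_term 2^-1 b 1 x (fun j => m j : nat) =
  (pi^-1)%:C * cintegral `]0, 1[ (fun u =>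
     \prod_j (inv_sqrt_poly N).[tnth x j * u%:C] * (arcsine_weight u)%:C).
Proof.
move=> bE.
have iM M : mu.-integrable `]0, 1[ (EFin \o (fun u => arcsine_weight u * u ^+ M)).
  by apply: integrable_arcsine_mul => u _; exact: exprn_continuous.
pose p (m : {ffun 'I_n -> 'I_N}) := \prod_j (central_coef (m j) * tnth x j ^+ m j).
rewrite (_ : cintegral _ _ = cintegral `]0, 1[ (fun u =>
    \sum_(m : {ffun 'I_n -> 'I_N}) p m *
       (arcsine_weight u * u ^+ (\sum_j (m j : nat)))%:C)); last first.
  congr cintegral; apply/funext => u.
  under eq_bigr do rewrite inv_sqrt_polyE.
  rewrite bigA_distr_bigA mulr_suml; apply: eq_bigr => m _.
  rewrite rmorphM mulrCA mulrC; congr (_ * _).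
  rewrite rmorphXn/= -prodrXr /p -big_split/=; apply: eq_bigr => j _.
  by rewrite exprMn mulrA.
rewrite (cintegral_lincomb _ _ _ _ p
  (fun m u => arcsine_weight u * u ^+ (\sum_j (m j : nat))))//.
rewrite mulr_sumr; apply: eq_bigr => m _.
rewrite lauricellaD_term_half// -/(p m) central_coef_real mulrC mulrCA; congr (_ * _).
rewrite -rmorphM /Rintegral integral_arcsine_moment /= mulrA mulVf ?mul1r//.
by rewrite gt_eqF// pi_gt0.
Qed.

End Series.

(** * The Lauricella series as an Euler integral *)

Section SeriesIntegral.
Context {R : realType}.
Notation mu := (@lebesgue_measure R).

Lemma inv_sqrt_poly_real N (x : R) :
  (inv_sqrt_poly N).[x%:C] = ((inv_sqrt_poly N).[x])%:C.
Proof.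
rewrite !inv_sqrt_polyE rmorph_sum; apply: eq_bigr => k _.
by rewrite rmorphM rmorphXn central_coef_real.
Qed.

Lemma inv_sqrt_poly_conj N (z : R[i]) :
  (inv_sqrt_poly N).[conjc z] = conjc (inv_sqrt_poly N).[z].
Proof.
rewrite !inv_sqrt_polyE rmorph_sum; apply: eq_bigr => k _.
rewrite rmorphM rmorphXn; congr (_ * _).
by rewrite central_coef_real; exact/esym/conjc_real.
Qed.

Definition lauricella_partial_integrand (x : R) (z : R[i]) N (u : R) : R :=
  (inv_sqrt_poly N).[x * u] * Normc.normc (inv_sqrt_poly N).[z * u%:C] ^+ 2.

(** The factors at z and at its conjugate are conjugate. *)
Lemma lauricellaD_partial_sum_real (x : R) (z : R[i]) N :
  \sum_(m : {ffun 'I_3 -> 'I_N})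
    lauricellaD_term 2^-1 [tuple 2^-1; 2^-1; 2^-1] 1 [tuple x%:C; z; conjc z]
      (fun j => m j : nat) =
  (pi^-1 * \int[mu]_(u in `]0, 1[)
             (arcsine_weight u * lauricella_partial_integrand x z N u))%:C.
Proof.
rewrite lauricellaD_partial_sum; last first.
  by case=> -[|[|[|]]]// i; rewrite (tnth_nth 0).
rewrite rmorphM; congr (_ * _); apply: cintegral_real => u _.
rewrite !big_ord_recl big_ord0 mulr1 !(tnth_nth 0)/=.
have -> : conjc z * u%:C = conjc (z * u%:C).
  by rewrite rmorphM; congr (_ * _); exact/esym/conjc_real.
rewrite -rmorphM inv_sqrt_poly_real inv_sqrt_poly_conj -sqr_normc norm_normc.
by rewrite -rmorphXn -!rmorphM mulrC.
Qed.

Lemma normc_mul_segment (z : R[i]) (u : R) : 0 <= u <= 1 ->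
  Normc.normc (z * u%:C) <= Normc.normc z.
Proof.
by move=> /andP[u0 u1]; rewrite Normc.normcM normc_real// ler_piMr// normc_ge0.
Qed.

Lemma norm_mul_segment (x u : R) : 0 <= u <= 1 -> `|x * u| <= `|x|.
Proof. by move=> /andP[u0 u1]; rewrite normrM (ger0_norm u0) ler_piMr. Qed.

Lemma lauricella_partial_integrand_cvg (x : R) (z : R[i]) (u : R) :
  `|x| < 1 -> Normc.normc z < 1 -> 0 <= u <= 1 ->
  lauricella_partial_integrand x z N u @[N --> \oo] -->
  lauricella_integrand x z u.
Proof.
move=> x1 z1 u01; rewrite /lauricella_integrand invfM; apply: cvgM.
  by apply: inv_sqrt_poly_cvg; exact: le_lt_trans (norm_mul_segment x _ u01) x1.
apply: sqr_normc_inv_sqrt_poly_cvg.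
exact: le_lt_trans (normc_mul_segment z _ u01) z1.
Qed.

Lemma lauricella_partial_integrand_bound (x : R) (z : R[i]) N (u : R) :
  `|x| < 1 -> Normc.normc z < 1 -> 0 <= u <= 1 ->
  `|lauricella_partial_integrand x z N u| <=
  (1 - `|x|)^-1 * (1 - Normc.normc z)^-1 ^+ 2.
Proof.
move=> x1 z1 u01; rewrite normrM ler_pM//.
  exact: inv_sqrt_poly_bound (norm_mul_segment x _ u01) x1.
rewrite normrX ger0_norm ?normc_ge0// lerXn2r ?nnegrE ?normc_ge0//.
  by rewrite invr_ge0 subr_ge0 ltW.
have := @inv_sqrt_poly_bound _ N (z * u%:C) (Normc.normc z)%:C.
rewrite norm_normc lecR ltcR => /(_ (normc_mul_segment z _ u01) z1).
by rewrite -(rmorph1 (real_complex R)) -rmorphB -fmorphV norm_normc lecR.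
Qed.

(** The squared modulus of a polynomial in the real variable u is the sum of
    the squares of two real polynomials. *)
Lemma lauricella_partial_integrand_continuous (x : R) (z : R[i]) N :
  continuous (lauricella_partial_integrand x z N).
Proof.
have cpoly (c : nat -> R) : continuous (fun u : R => \sum_(k < N) c k * u ^+ k).
  rewrite (_ : (fun u => _) = horner (\poly_(k < N) c k)).
    by move=> u; exact: continuous_horner.
  by apply/funext => u; rewrite horner_poly.
have csqr (c : nat -> R) :
    continuous (fun u : R => (\sum_(k < N) c k * u ^+ k) ^+ 2).
  move=> u; apply: (@continuous_comp _ _ _ _ (fun v : R => v ^+ 2)).
    exact: cpoly.
  exact: exprn_continuous.
have c1 : continuous (fun u : R => (inv_sqrt_poly N).[x * u]).
  rewrite (_ : (fun u => _) = fun u =>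
      \sum_(k < N) (central_coef k * x ^+ k) * u ^+ k).
    exact: (cpoly (fun k => central_coef k * x ^+ k)).
  apply/funext => v; rewrite inv_sqrt_polyE; apply: eq_bigr => k _.
  by rewrite exprMn mulrA.
have c2 : continuous (fun u : R => Normc.normc (inv_sqrt_poly N).[z * u%:C] ^+ 2).
  pose p k : R[i] := central_coef k * z ^+ k.
  rewrite (_ : (fun u => _) = fun u : R =>
      (\sum_(k < N) complex.Re (p k) * u ^+ k) ^+ 2 +
      (\sum_(k < N) complex.Im (p k) * u ^+ k) ^+ 2).
    move=> u; apply: cvgD; first exact: (csqr (fun k => complex.Re (p k))).
    exact: (csqr (fun k => complex.Im (p k))).
  apply/funext => v.
  have -> : (inv_sqrt_poly N).[z * v%:C] = \sum_(k < N) p k * (v ^+ k)%:C.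
    rewrite inv_sqrt_polyE; apply: eq_bigr => k _.
    by rewrite exprMn mulrA rmorphXn.
  by rewrite sum_mul_real /= sqr_sqrtr// addr_ge0 ?sqr_ge0.
by move=> u; apply: cvgM; [exact: c1|exact: c2].
Qed.

Lemma lauricellaD_seriesE (x : R) (z : R[i]) :
  `|x| < 1 -> Normc.normc z < 1 ->
  lauricellaD_series (2^-1 : R[i]) [tuple 2^-1; 2^-1; 2^-1] 1
    [tuple x%:C; z; conjc z] =
  (pi^-1 * \int[mu]_(u in `]0, 1[)
             (arcsine_weight u * lauricella_integrand x z u))%:C.
Proof.
move=> x1 z1.
pose f N (u : R) := arcsine_weight u * lauricella_partial_integrand x z N u.
pose fl (u : R) := arcsine_weight u * lauricella_integrand x z u.
pose C := (1 - `|x|)^-1 * (1 - Normc.normc z)^-1 ^+ 2.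
have fi N : mu.-integrable `]0, 1[ (EFin \o f N).
  apply: integrable_arcsine_mul => u _.
  exact: lauricella_partial_integrand_continuous.
have ff u : 0 < u < 1 -> f N u @[N --> \oo] --> fl u.
  move=> /andP[u0 u1]; apply: cvgM; first exact: cvg_cst.
  by apply: lauricella_partial_integrand_cvg; rewrite ?ltW.
have mf N : measurable_fun (`]0, 1[ : set R) (EFin \o f N).
  exact: measurable_int (fi N).
have [fli _ cv] : [/\ mu.-integrable `]0%R, 1%R[ (EFin \o fl),
   [sequence \int[mu]_(u in `]0%R, 1%R[) `|(f N u)%:E - (fl u)%:E|]_N @ \oo --> 0 &
   [sequence \int[mu]_(u in `]0%R, 1%R[) (f N u)%:E]_N @ \oo -->
     \int[mu]_(u in `]0%R, 1%R[) (fl u)%:E]%E.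
  apply: (@dominated_convergence _ _ _ mu _ _ (fun N => EFin \o f N) (EFin \o fl)
     (EFin \o (fun u => C * arcsine_weight u))) => //.
  - apply: (emeasurable_fun_cvg _ _ mf) => u; rewrite /= in_itv/= => u01.
    by apply: cvg_EFin; [exact: nearW|exact: ff].
  - apply: aeW => u; rewrite /= in_itv/= => u01.
    by apply: cvg_EFin; [exact: nearW|exact: ff].
  - exact: integrableZ integrable_arcsine_weight.
  - apply: aeW => u N; rewrite /= in_itv/= => /andP[u0 u1].
    rewrite /f lee_fin normrM (ger0_norm (arcsine_weight_ge0 u)) mulrC.
    rewrite ler_wpM2r ?arcsine_weight_ge0//.
    by apply: lauricella_partial_integrand_bound; rewrite ?ltW.
have cvI : \int[mu]_(u in `]0, 1[) f N u @[N --> \oo] -->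
    \int[mu]_(u in `]0, 1[) fl u.
  apply: fine_cvg; rewrite fineK//.
  exact: integrable_fin_num.
rewrite /lauricellaD_series (_ : (fun N => _) = (fun N =>
   (pi^-1 * \int[mu]_(u in `]0, 1[) f N u)%:C)); last first.
  by apply/funext => N; exact: lauricellaD_partial_sum_real.
rewrite /climn/=; congr Complex; last by rewrite lim_cst.
by apply/cvg_lim => //; apply: cvgM => //; exact: cvg_cst.
Qed.

(** The value is a series inside the polydisc and an integral outside; past
    this point only the integral matters. *)
Lemma lauricellaD_halfE (x : R) (z : R[i]) : x < 1 ->
  complex.Im z != 0 \/ complex.Re z < 1 ->
  lauricellaD (2^-1 : R[i]) [tuple 2^-1; 2^-1; 2^-1] 1
    [tuple x%:C; z; conjc z] =
  (pi^-1 * \int[mu]_(u in `]0, 1[)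
             (arcsine_weight u * lauricella_integrand x z u))%:C.
Proof.
move=> x1 z1; rewrite /lauricellaD; case: ifPn => [/forallP h|_].
  apply: lauricellaD_seriesE.
    have := h (Ordinal (isT : 0 < 3)%N); rewrite (tnth_nth 0)/= norm_normc ltcR.
    by rewrite /= expr0n addr0 sqrtr_sqr.
  by have := h (Ordinal (isT : 1 < 3)%N); rewrite (tnth_nth 0)/= norm_normc ltcR.
exact: lauricellaD_integralE.
Qed.

End SeriesIntegral.

(** * The points of the identity *)

Section Assembly.
Context {R : realType}.
Notation mu := (@lebesgue_measure R).

Lemma cos_double (a : R) : cos (2 * a) = 2 * cos a ^+ 2 - 1.
Proof. by rewrite mulr_natl cos_mulr2n -mulr_natl. Qed.

Lemma cexp_2i (a : R) : cexp (2 * 'i%C * a%:C) = cos (2 * a) +i* sin (2 * a).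
Proof.
have -> : 2 * 'i%C * a%:C = 0 +i* (2 * a).
  by apply/eqP; rewrite eq_complex/=; apply/andP; split; apply/eqP; ring.
by rewrite /cexp/= expR0 mul1r.
Qed.

Lemma cexp_N2i (a : R) :
  cexp (- (2 * 'i%C * a%:C)) = conjc (cexp (2 * 'i%C * a%:C)).
Proof.
have -> : - (2 * 'i%C * a%:C) = 2 * 'i%C * (- a)%:C by rewrite rmorphN mulrN.
by rewrite !cexp_2i mulrN cosN sinN.
Qed.

(** 1 - B e^(-it), the inverse of the second variable when B = b^2 and t =
    2a. *)
Definition circle_denominator (B t : R) : R[i] :=
  (1 - B * cos t) +i* (B * sin t).

Lemma normc_circle_denominator (B t u : R) :
  Normc.normc (circle_denominator B t - u%:C) =
  Num.sqrt (quad B (2 * cos t) (1 - u)).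
Proof.
rewrite /= subr0; congr Num.sqrt.
rewrite exprMn sin2cos2 /quad; ring.
Qed.

(** 1 - x u is (1/x - u) x for each variable, and the modulus of (1 - B
    e^(-it)) - u is the square root of q_(2 cos t)(1 - u). *)
Lemma lauricella_integrand_circle (B t u : R) : 1 < B -> 0 <= u <= 1 ->
  lauricella_integrand (1 / (1 - B ^+ 2)) (1 / circle_denominator B t) u =
  Num.sqrt (B ^+ 2 - 1) * Num.sqrt (quad B (2 * cos t) 1) / B *
  hyperelliptic_kernel B (cos t) u.
Proof.
move=> B1 /andP[u0 u1].
have B0 : 0 < B by exact: lt_trans ltr01 B1.
have B21 : 0 < B ^+ 2 - 1 by rewrite subr_gt0 expr_gt1// ltW.
have e2 : 2 * cos t <= 2 by rewrite ler_piMr// cos_le1.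
have v01 : 0 <= 1 - u <= 1 by rewrite subr_ge0 u1 gerBl.
have Q0 := quad_gt0 B _ _ B1 e2 v01.
have S0 : 0 < quad B (2 * cos t) 1 by rewrite quad_gt0// ler01 lexx.
have d0 : 0 < B ^+ 2 - (1 - u) by case/andP: v01 => _ v1; lra.
have nw : Normc.normc (circle_denominator B t) = Num.sqrt (quad B (2 * cos t) 1).
  by have := normc_circle_denominator B t 0; rewrite rmorph0 !subr0.
have w0 : circle_denominator B t != 0.
  apply/eqP => w0; move: nw; rewrite w0 Normc.normc0 => /esym/eqP.
  by rewrite sqrtr_eq0 leNgt S0.
rewrite /lauricella_integrand /hyperelliptic_kernel.
have -> : 1 - 1 / (1 - B ^+ 2) * u = (B ^+ 2 - (1 - u)) / (B ^+ 2 - 1).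
  by field; rewrite lt0r_neq0// -opprB oppr_eq0 lt0r_neq0.
have -> : 1 - 1 / circle_denominator B t * u%:C =
    (circle_denominator B t - u%:C) / circle_denominator B t by field.
rewrite Normc.normcM Normc.normcV normc_circle_denominator nw.
rewrite !(sqrtrM _ (ltW d0)) sqrtrV ?ltW//.
by field; rewrite !lt0r_neq0 ?sqrtr_gt0.
Qed.

End Assembly.

Theorem theorem4p8 (R : realType) (a b : R) (hb : 1 < b) :
  (pi : R)%:C =
    (Num.sqrt (b ^+ 4 - 1)
       * Num.sqrt (1 - 2 * b ^+ 2 * cos (2 * a) + b ^+ 4))%:C
    / ((b ^+ 2)%:C
       * lauricellaD (2^-1 : R[i]) [tuple 2^-1; 2^-1; 2^-1] 1
           [tuple 1 / (1 - b%:C ^+ 4);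
                  1 / (1 - b%:C ^+ 2 * cexp (- (2 * 'i%C * a%:C)));
                  1 / (1 - b%:C ^+ 2 * cexp (2 * 'i%C * a%:C))])
    * (ellipticK (2 * b * sin a
                    / Num.sqrt (1 - 2 * b ^+ 2 * cos (2 * a) + b ^+ 4))
         / Num.sqrt (1 - 2 * b ^+ 2 * cos (2 * a) + b ^+ 4)
       + ellipticK (2 * b * cos a / (1 + b ^+ 2)) / (1 + b ^+ 2))%:C.
Proof.
have b0 : 0 < b by exact: lt_trans ltr01 hb.
pose B := b ^+ 2; pose t := 2 * a; pose c := cos t.
have B1 : 1 < B by rewrite expr_gt1// ltW.
have B0 : 0 < B by exact: lt_trans ltr01 B1.
have c1 : c <= 1 by exact: cos_le1.
have e2 : 2 * c <= 2 by rewrite ler_piMr.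
have S0 : 0 < quad B (2 * c) 1 by rewrite quad_gt0// ler01 lexx.
have -> : 1 - 2 * b ^+ 2 * cos (2 * a) + b ^+ 4 = quad B (2 * c) 1.
  by rewrite /quad /B /c /t; ring.
have -> : b ^+ 4 = B ^+ 2 by rewrite -exprM.
rewrite -/B.
have -> : 1 / (1 - b%:C ^+ 4) = (1 / (1 - B ^+ 2))%:C.
  by rewrite -exprM !div1r fmorphV rmorphB rmorph1 rmorphXn.
have wE : 1 - b%:C ^+ 2 * cexp (- (2 * 'i%C * a%:C)) = circle_denominator B t.
  rewrite cexp_N2i cexp_2i -rmorphXn; apply/eqP; rewrite eq_complex/=.
  by apply/andP; split; apply/eqP; rewrite /B /t; ring.
have w'E : 1 - b%:C ^+ 2 * cexp (2 * 'i%C * a%:C) = conjc (circle_denominator B t).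
  rewrite cexp_2i -rmorphXn; apply/eqP; rewrite eq_complex/=.
  by apply/andP; split; apply/eqP; rewrite /B /t; ring.
rewrite wE w'E.
have -> : 1 / conjc (circle_denominator B t) = conjc (1 / circle_denominator B t).
  by rewrite !div1r conjc_inv.
have x1 : 1 / (1 - B ^+ 2) < 1.
  by rewrite (lt_trans _ ltr01)// div1r invr_lt0 subr_lt0 expr_gt1// ltW.
have z1 : complex.Re (1 / circle_denominator B t) < 1.
  rewrite div1r /= -/c.
  have -> : (1 - B * c) ^+ 2 + (B * sin t) ^+ 2 = quad B (2 * c) 1.
    by rewrite exprMn sin2cos2 -/c /quad; ring.
  rewrite ltr_pdivrMr// mul1r -subr_gt0.
  have -> : quad B (2 * c) 1 - (1 - B * c) = B * (B - c) by rewrite /quad; ring.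
  by rewrite mulr_gt0// subr_gt0 (le_lt_trans c1).
rewrite lauricellaD_halfE//; last by right.
pose J := \int[lebesgue_measure]_(u in `]0, 1[)
  (arcsine_weight u * hyperelliptic_kernel B c u).
have -> : \int[lebesgue_measure]_(u in `]0, 1[) (arcsine_weight u *
    lauricella_integrand (1 / (1 - B ^+ 2)) (1 / circle_denominator B t) u) =
    Num.sqrt (B ^+ 2 - 1) * Num.sqrt (quad B (2 * c) 1) / B * J.
  rewrite -RintegralZl//; last first.
    by apply: integrable_arcsine_mul; exact: hyperelliptic_kernel_continuous.
  apply: eq_Rintegral => u; rewrite inE/= in_itv/= => /andP[u0 u1].
  by rewrite lauricella_integrand_circle// ?ltW// mulrCA.
have -> : ellipticK (2 * b * sin a / Num.sqrt (quad B (2 * c) 1)) /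
      Num.sqrt (quad B (2 * c) 1) +
    ellipticK (2 * b * cos a / (1 + B)) / (1 + B) = J.
  apply: ellipticK_sum => //.
    rewrite expr_div_n sqr_sqrtr ?ltW// divfK ?lt0r_neq0//.
    by rewrite !exprMn sin2cos2 /c /t cos_double /B; ring.
  rewrite expr_div_n divfK ?lt0r_neq0 ?exprn_gt0 ?addr_gt0//.
  by rewrite !exprMn /c /t cos_double /B; ring.
have J0 : 0 < J.
  apply: Rintegral_arcsine_mul_gt0; first exact: hyperelliptic_kernel_continuous.
  by move=> u; exact: hyperelliptic_kernel_gt0.
have s0 : 0 < Num.sqrt (B ^+ 2 - 1).
  by rewrite sqrtr_gt0 subr_gt0 expr_gt1// ltW.
rewrite -rmorphM -fmorphV -!rmorphM; congr (_%:C).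
have s1 : 0 < Num.sqrt (quad B (2 * c) 1) by rewrite sqrtr_gt0.
have := pi_gt0 R; move: pi => p p0.
by field; rewrite !lt0r_neq0.
Qed.
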